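(* In the abstract setting described in the context, let the iterative solver satisfy (C1) or (C2), with $\mathrm{d}(\cdot,\cdot)$ defined according to the assumed property, let the mesh-refinement satisfy (R1)–(R3), and let the error estimator satisfy (A1)–(A4). Define $$\lambda_{\rm opt}:=\begin{cases}\dfrac{1-q_{\rm ctr}}{q_{\rm ctr}\,C_{\rm stab}} & \text{in case of (C2)},\\[2mm] \dfrac{1-q_{\rm ctr}}{q_{\rm ctr}\,C_{\rm stab}}\,\sqrt{\alpha/2} & \text{otherwise, i.e., in case of (C1)}.\end{cases}$$ Let $0<\theta\le1$ and $0<\lambda_{\rm ctr}<\lambda_{\rm opt}\,\theta$ be such that $$0<\theta':=\frac{\theta+\lambda_{\rm ctr}/\lambda_{\rm opt}}{1-\lambda_{\rm ctr}/\lambda_{\rm opt}}<(1+C_{\rm stab}^2C_{\rm rel}^2)^{-1/2}.$$ Let $s>0$. Then there exist constants $c_{\rm opt},C_{\rm opt}>0$ such that $$c_{\rm opt}^{-1}\,\|u^\star\|_{\mathbb{A}_s}\le\sup_{(\ell',k')\in\mathcal{Q}}(\#\mathcal{T}_{\ell'}-\#\mathcal{T}_0+1)^s\,\Delta_{\ell'}^{k'}\le\sup_{(\ell',k')\in\mathcal{Q}}\bigg(\sum_{\substack{(\ell,k)\in\mathcal{Q}\\(\ell,k)\le(\ell',k')}}\#\mathcal{T}_\ell\bigg)^s\Delta_{\ell'}^{k'}\le C_{\rm opt}\,\max\{\|u^\star\|_{\mathbb{A}_s},\Delta_0^0\}.$$ The constant $c_{\rm opt}$ depends only on $L/\alpha$,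 $C_{\rm son}$, $C_{\rm stab}$, $C_{\rm rel}$, $\#\mathcal{T}_0$, and $s$, and additionally on $\underline\ell$ resp. $\ell_0$ if $\underline\ell<\infty$ or $\eta_{\ell_0}(u_{\ell_0}^{\underline{k}(\ell_0)})=0$ for some $\ell_0$ with $(\ell_0+1,0)\in\mathcal{Q}$. The constant $C_{\rm opt}$ depends only on $C_{\rm stab}$, $q_{\rm red}$, $C_{\rm rel}$, $C_{\rm mesh}$, $1-\lambda_{\rm ctr}/\lambda_{\rm opt}$, $C_{\rm mark}$, $C_{\rm rel}'$, $C_{\rm lin}$, $q_{\rm lin}$, $\#\mathcal{T}_0$, and $s$.
   Context: **Model problem.** $\mathcal{H}$ is a Hilbert space over $\mathbb{K}\in\{\mathbb{R},\mathbb{C}\}$ with norm $\|\cdot\|$ (induced by its scalar product) and dual space $\mathcal{H}'$ with norm $\|\cdot\|'$. $P:\mathcal{H}\to\mathbb{K}$ is Gâteaux differentiable with derivative $\mathcal{A}:\mathcal{H}\to\mathcal{H}'$, i.e., $\langle\mathcal{A}w,v\rangle=\lim_{t\to0,\,t\in\mathbb{R}}(P(w+tv)-P(w))/t$ for all $v,w\in\mathcal{H}$, where $\langle\cdot,\cdot\rangle$ is the duality pairing on $\mathcal{H}'\times\mathcal{H}$. There are constants $0<\alpha\le L$ such that $\alpha\|w-v\|^2\le\mathrm{Re}\,\langle\mathcal{A}w-\mathcal{A}v,w-v\rangle$ and $\|\mathcal{A}w-\mathcal{A}v\|'\le L\|w-v\|$ for all $v,w\in\mathcal{H}$. Let $F\in\mathcal{H}'$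 and $\mathcal{E}:=\mathrm{Re}\,(P-F)$. For each closed subspace $\mathcal{X}_H\subseteq\mathcal{H}$, $u_H^\star\in\mathcal{X}_H$ denotes the unique solution of $\langle\mathcal{A}u_H^\star,v_H\rangle=\langle F,v_H\rangle$ for all $v_H\in\mathcal{X}_H$; $u^\star\in\mathcal{H}$ denotes the solution for $\mathcal{X}_H=\mathcal{H}$. **Meshes and spaces.** $\mathcal{T}_0$ is an initial mesh (a finite set of elements). A fixed refinement strategy is given: for a mesh $\mathcal{T}_H$ and $\mathcal{M}_H\subseteq\mathcal{T}_H$, $\mathcal{T}_h=\mathtt{refine}(\mathcal{T}_H,\mathcal{M}_H)$ is the coarsest one-level refinement of $\mathcal{T}_H$ in which all elements of $\mathcal{M}_H$ have been refined, i.e., $\mathcal{M}_H\subseteq\mathcal{T}_H\setminus\mathcal{T}_h$. $\mathtt{refine}(\mathcal{T}_H)$ is the set of meshes obtained from $\mathcal{T}_H$ by finitely many (possibly zero) such steps, with arbitrary marked elements in each step, and $\mathbb{T}:=\mathtt{refine}(\mathcal{T}_0)$. Each $\mathcal{T}_H\in\mathbb{T}$ has an associated finite-dimensional subspace $\mathcal{X}_H\subset\mathcal{H}$, with $\mathcal{X}_H\subseteq\mathcal{X}_h$ whenever $\mathcal{T}_h\in\mathtt{refine}(\mathcal{T}_H)$. Quantities belonging to $\mathcal{T}_H$, $\mathcal{T}_h$, $\mathcal{T}_\ell$ carry the index $H$, $h$, $\ell$. With constants $C_{\rm son}\ge2$, $C_{\rm mesh}>0$, the refinement properties are: - (R1)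 For all $\mathcal{T}_H\in\mathbb{T}$, $\mathcal{M}_H\subseteq\mathcal{T}_H$, the mesh $\mathcal{T}_h=\mathtt{refine}(\mathcal{T}_H,\mathcal{M}_H)$ satisfies $\#(\mathcal{T}_H\setminus\mathcal{T}_h)+\#\mathcal{T}_H\le\#\mathcal{T}_h\le C_{\rm son}\,\#(\mathcal{T}_H\setminus\mathcal{T}_h)+\#(\mathcal{T}_H\cap\mathcal{T}_h)$. - (R2) For all $\mathcal{T}\in\mathbb{T}$ and $\mathcal{T}_H,\mathcal{T}_h\in\mathtt{refine}(\mathcal{T})$ there is a common refinement $\mathcal{T}_H\oplus\mathcal{T}_h\in\mathtt{refine}(\mathcal{T}_H)\cap\mathtt{refine}(\mathcal{T}_h)\subseteq\mathtt{refine}(\mathcal{T})$ with $\#(\mathcal{T}_H\oplus\mathcal{T}_h)\le\#\mathcal{T}_H+\#\mathcal{T}_h-\#\mathcal{T}$. - (R3) For each sequence with $\mathcal{T}_{\ell+1}=\mathtt{refine}(\mathcal{T}_\ell,\mathcal{M}_\ell)$, $\mathcal{M}_\ell\subseteq\mathcal{T}_\ell$, $\ell\in\mathbb{N}_0$ (starting from $\mathcal{T}_0$), it holds that $\#\mathcal{T}_\ell-\#\mathcal{T}_0\le C_{\rm mesh}\sum_{j=0}^{\ell-1}\#\mathcal{M}_j$. **Estimator.** For $\mathcal{T}_H\in\mathbb{T}$, $T\in\mathcal{T}_H$, $v_H\in\mathcal{X}_H$, numbers $\eta_H(T,v_H)\ge0$ are given; $\eta_H(\mathcal{U}_H,v_H):=\big(\sum_{T\in\mathcal{U}_H}\eta_H(T,v_H)^2\big)^{1/2}$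 for $\mathcal{U}_H\subseteq\mathcal{T}_H$, and $\eta_H(v_H):=\eta_H(\mathcal{T}_H,v_H)$. With constants $C_{\rm stab},C_{\rm rel}>0$ and $0<q_{\rm red}<1$, for all $\mathcal{T}_H\in\mathbb{T}$ and $\mathcal{T}_h\in\mathtt{refine}(\mathcal{T}_H)$: - (A1) $|\eta_h(\mathcal{U}_H,v_h)-\eta_H(\mathcal{U}_H,w_H)|\le C_{\rm stab}\|v_h-w_H\|$ for all $v_h\in\mathcal{X}_h$, $w_H\in\mathcal{X}_H$, $\mathcal{U}_H\subseteq\mathcal{T}_H\cap\mathcal{T}_h$. - (A2) $\eta_h(\mathcal{T}_h\setminus\mathcal{T}_H,v_H)\le q_{\rm red}\,\eta_H(\mathcal{T}_H\setminus\mathcal{T}_h,v_H)$ for all $v_H\in\mathcal{X}_H$. - (A3) $\|u^\star-u_H^\star\|\le C_{\rm rel}\,\eta_H(u_H^\star)$. - (A4) $\|u_h^\star-u_H^\star\|\le C_{\rm rel}\,\eta_H(\mathcal{T}_H\setminus\mathcal{T}_h,u_H^\star)$. **Solver.** For each $\mathcal{T}_H\in\mathbb{T}$ a map $\Phi_H:\mathcal{X}_H\to\mathcal{X}_H$ is given. With a constant $0<q_{\rm ctr}<1$ independent of $\mathcal{T}_H$, the two possible contraction properties are, for all $\mathcal{T}_H\in\mathbb{T}$ and $v_H\in\mathcal{X}_H$: - (C1) $\mathcal{E}(\Phi_H(v_H))-\mathcal{E}(u_H^\star)\le q_{\rm ctr}^2\,(\mathcal{E}(v_H)-\mathcal{E}(u_H^\star))$;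 - (C2) $\|u_H^\star-\Phi_H(v_H)\|\le q_{\rm ctr}\,\|u_H^\star-v_H\|$. Set $\mathrm{d}(w,v):=|\mathcal{E}(v)-\mathcal{E}(w)|^{1/2}$ in case of (C1), and $\mathrm{d}(w,v):=\|w-v\|$ in case of (C2). **Adaptive algorithm.** Input: $\mathcal{T}_0$, $u_0^0\in\mathcal{X}_0$, $0<\theta\le1$, $\lambda_{\rm ctr}>0$, $C_{\rm mark}\ge1$. For $\ell=0,1,2,\dots$: for $k=1,2,\dots$ compute $u_\ell^k:=\Phi_\ell(u_\ell^{k-1})$ and $\eta_\ell(T,u_\ell^k)$ for $T\in\mathcal{T}_\ell$, until for the first time $\mathrm{d}(u_\ell^k,u_\ell^{k-1})\le\lambda_{\rm ctr}\,\eta_\ell(u_\ell^k)$; then set $\underline{k}(\ell):=k$, choose $\mathcal{M}_\ell\subseteq\mathcal{T}_\ell$ with $\theta\,\eta_\ell(u_\ell^{\underline{k}(\ell)})\le\eta_\ell(\mathcal{M}_\ell,u_\ell^{\underline{k}(\ell)})$ whose cardinality is, up to the factor $C_{\rm mark}$, minimal among all such sets, set $\mathcal{T}_{\ell+1}:=\mathtt{refine}(\mathcal{T}_\ell,\mathcal{M}_\ell)$, $u_{\ell+1}^0:=u_\ell^{\underline{k}(\ell)}$, and continue with $\ell+1$. If the stopping criterion is never met on level $\ell$, then $\underline{k}(\ell):=\infty$ and no later level is reached. **Indices and quasi-error.** $\mathcal{Q}:=\{(\ell,k)\in\mathbb{N}_0^2:\ (\ell,k)\text{ is reached by the algorithm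 and }k<\underline{k}(\ell)\}$, ordered by order of appearance in the algorithm (lexicographically). $|(\ell,k)|:=\#\{(\ell',k')\in\mathcal{Q}:(\ell',k')<(\ell,k)\}$. $\underline\ell:=\sup\{\ell\in\mathbb{N}_0:(\ell,0)\in\mathcal{Q}\}\in\mathbb{N}_0\cup\{\infty\}$. $\Delta_\ell^k:=\|u^\star-u_\ell^k\|+\eta_\ell(u_\ell^k)$. **Constants $C_{\rm lin},q_{\rm lin},C_{\rm rel}'$.** $C_{\rm lin}\ge1$ and $0<q_{\rm lin}<1$ are constants of linear convergence, i.e., $\Delta_\ell^k\le C_{\rm lin}\,q_{\rm lin}^{|(\ell,k)|-|(\ell',k')|}\Delta_{\ell'}^{k'}$ for all $(\ell',k')<(\ell,k)$ in $\mathcal{Q}$; such constants exist under the present assumptions and depend only on $L/\alpha$, $C_{\rm stab}$, $q_{\rm red}$, $C_{\rm rel}$, $q_{\rm ctr}$, $\theta$, $\lambda_{\rm ctr}$ (and on $L$ in case of (C1)). $C_{\rm rel}'>0$ is a constant of a posteriori error control, i.e., $\Delta_\ell^k\le C_{\rm rel}'(\eta_\ell(u_\ell^k)+\mathrm{d}(u_\ell^k,u_\ell^{k-1}))$ for $0<k\le\underline{k}(\ell)$ ($k<\infty$), $\Delta_\ell^{\underline{k}(\ell)}\le C_{\rm rel}'\,\eta_\ell(u_\ell^{\underline{k}(\ell)})$ if $\underline{k}(\ell)<\infty$, and $\Delta_\ell^0\le C_{\rm rel}'\,\eta_{\ell-1}(u_\ell^0)$ for $\ell>0$; such a constant exists and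 depends only on $C_{\rm stab}$, $C_{\rm rel}$, $q_{\rm ctr}$, $\lambda_{\rm ctr}$ (and on $\alpha$ in case of (C1)). **Approximation class.** For $N\in\mathbb{N}_0$ let $\mathbb{T}(N):=\{\mathcal{T}\in\mathbb{T}:\#\mathcal{T}-\#\mathcal{T}_0\le N\}$. For $s>0$, $$\|u^\star\|_{\mathbb{A}_s}:=\sup_{N\in\mathbb{N}_0}(N+1)^s\inf_{\mathcal{T}_{\rm opt}\in\mathbb{T}(N)}\big(\|u^\star-u_{\rm opt}^\star\|+\eta_{\rm opt}(u_{\rm opt}^\star)\big)\in[0,\infty],$$ where $u_{\rm opt}^\star$ and $\eta_{\rm opt}$ are the exact discrete solution and the estimator associated with $\mathcal{T}_{\rm opt}$. All suprema take values in $[0,\infty]$. *)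

(* Defs.v *)
From HB Require Import structures.
From mathcomp Require Import all_boot all_order all_algebra finmap.
From mathcomp Require Import all_classical all_reals all_analysis.
From mathcomp Require Import complex.

Set Implicit Arguments.
Unset Strict Implicit.
Unset Printing Implicit Defensive.

Import Order.TTheory GRing.Theory Num.Theory.
Import numFieldNormedType.Exports.

Local Open Scope classical_set_scope.
Local Open Scope ring_scope.

Inductive scalars := RealScalars | ComplexScalars.

Definition scalar_field (R : realType) (k : scalars) : numFieldType :=
  match k with
  | RealScalars => R
  | ComplexScalars => R[i]
  end.

Definition scalar_re (R : realType) (k : scalars) : scalar_field R k -> R :=
  match k with
  | RealScalars => fun z => z
  | ComplexScalars => fun z => complex.Re z
  end.

Definition scalar_conj (R : realType) (k : scalars) :
    scalar_field R k -> scalar_field R k :=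
  match k with
  | RealScalars => fun z => z
  | ComplexScalars => fun z => conjc z
  end.

Definition scalar_of (R : realType) (k : scalars) : R -> scalar_field R k :=
  match k with
  | RealScalars => fun t => t
  | ComplexScalars => fun t => real_complex R t
  end.

(* Norms of [normedModType K] take values in [K]; these are the same
   nonnegative numbers, read in [R]. *)
Definition modulus (R : realType) (k : scalars) (z : scalar_field R k) : R :=
  scalar_re `|z|.

Definition hnorm (R : realType) (k : scalars)
    (H : completeNormedModType (scalar_field R k)) (x : H) : R :=
  scalar_re `|x|.

Record dual_space (R : realType) (k : scalars)
    (H : completeNormedModType (scalar_field R k)) := DualSpace {
  dual_fun :> {linear H -> (scalar_field R k)^o};
  dual_continuous : continuous dual_fun
}.

Definition dual_norm (R : realType) (k : scalars)
    (H : completeNormedModType (scalar_field R k))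
    (phi : H -> scalar_field R k) : \bar R :=
  ereal_sup [set (modulus (phi v))%:E | v in [set v : H | hnorm v <= 1]].

Definition gateaux_derivative (R : realType) (k : scalars)
    (H : completeNormedModType (scalar_field R k))
    (P : H -> scalar_field R k) (A : H -> dual_space H) : Prop :=
  forall w v : H,
    (P (w + scalar_of k t *: v) - P w) / scalar_of k t @[t --> (0 : R)^']
      --> (A w v : scalar_field R k).

Definition finite_dim_subspace (R : realType) (k : scalars)
    (H : completeNormedModType (scalar_field R k)) (X : set H) : Prop :=
  exists (n : nat) (e : 'I_n -> H),
    X = [set v | exists c : 'I_n -> scalar_field R k, v = \sum_(i < n) c i *: e i].

Record model (R : realType) (k : scalars) := Model {
  carrier :> completeNormedModType (scalar_field R k);
  inner : {dot carrier for @scalar_conj R k};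
  innerE : forall x : carrier, `|x| ^+ 2 = inner x x;
  potential : carrier -> scalar_field R k;
  operator : carrier -> dual_space carrier;
  operatorP : gateaux_derivative potential operator;
  rhs : dual_space carrier
}.

Definition strongly_monotone (R : realType) (k : scalars) (M : model R k)
    (alpha : R) : Prop :=
  forall v w : M, alpha * hnorm (w - v) ^+ 2
    <= scalar_re (operator w (w - v) - operator v (w - v) : scalar_field R k).

Definition lipschitz_operator (R : realType) (k : scalars) (M : model R k)
    (L : R) : Prop :=
  forall v w : M,
    (dual_norm (fun x => ((operator w x : scalar_field R k) - operator v x)%R)
    <= (L * hnorm (w - v)%R)%:E)%E.

Definition energy (R : realType) (k : scalars) (M : model R k) (v : M) : R :=
  scalar_re (potential v - rhs M v).

Definition galerkin (R : realType) (k : scalars) (M : model R k)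
    (X : set M) (u : M) : Prop :=
  X u /\ forall v, X v -> operator u v = rhs M v.

Local Open Scope fset_scope.
Local Open Scope ring_scope.

Inductive refinement (E : choiceType)
    (refine : {fset E} -> {fset E} -> {fset E}) (T : {fset E}) :
    {fset E} -> Prop :=
| refinement_refl : refinement refine T T
| refinement_step (T' marked : {fset E}) :
    refinement refine T T' -> marked `<=` T' ->
    refinement refine T (refine T' marked).

(* [estim T t v] is the indicator of the element [t] of the mesh [T];
   [discrete_sol T] is the exact Galerkin solution on [T]. Values at meshes outside
   [admissible], elements outside the mesh and functions outside the discrete
   space are irrelevant. *)
Record discretization (R : realType) (k : scalars) (M : model R k) :=
  Discretization {
  element : choiceType;
  mesh0 : {fset element};
  mesh0_neq0 : mesh0 != fset0;
  refine : {fset element} -> {fset element} -> {fset element};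
  admissible := refinement refine mesh0;
  refineP : forall T marked, admissible T -> marked `<=` T ->
    marked `<=` T `\` refine T marked;
  dspace : {fset element} -> set M;
  dspaceP : forall T, admissible T -> finite_dim_subspace (dspace T);
  dspace_nested : forall T T', admissible T -> refinement refine T T' ->
    (dspace T `<=` dspace T')%classic;
  exact_sol : M;
  exact_solP : galerkin setT exact_sol;
  discrete_sol : {fset element} -> M;
  discrete_solP : forall T, admissible T -> galerkin (dspace T) (discrete_sol T);
  estim : {fset element} -> element -> M -> R;
  estim_ge0 : forall T t v, admissible T -> t \in T -> dspace T v ->
    0 <= estim T t v;
  solver : {fset element} -> M -> M;
  solver_dspace : forall T v, admissible T -> dspace T v ->
    dspace T (solver T v)
}.

Arguments refine {R k M} d.
Arguments discrete_sol {R k M} d.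

Section Discretization.
Context (R : realType) (k : scalars) (M : model R k) (D : discretization M).
Implicit Types (T TH Th U : {fset element D}) (v w : M).

Definition refines T T' : Prop := refinement (refine D) T T'.

Definition estimator T U v : R := Num.sqrt (\sum_(t <- U) estim T t v ^+ 2).

Definition son_estimate (Cson : R) : Prop :=
  forall T marked, admissible T -> marked `<=` T ->
  let Th := refine D T marked in
  (#|` T `\` Th| + #|` T| <= #|` Th|)%N /\
  #|` Th|%:R <= Cson * #|` T `\` Th|%:R + #|` T `&` Th|%:R.

Definition overlay_estimate : Prop :=
  forall T TH Th, admissible T -> refines T TH -> refines T Th ->
  exists Toverlay, [/\ refines TH Toverlay, refines Th Toverlay &
    #|` Toverlay|%:R <= #|` TH|%:R + #|` Th|%:R - #|` T|%:R :> R].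

Definition closure_estimate (Cmesh : R) : Prop :=
  forall Ts marked : nat -> {fset element D},
  Ts 0 = mesh0 D ->
  (forall l, marked l `<=` Ts l /\ Ts l.+1 = refine D (Ts l) (marked l)) ->
  forall l, #|` Ts l|%:R - #|` mesh0 D|%:R
    <= Cmesh * \sum_(j < l) #|` marked j|%:R.

Definition stability (Cstab : R) : Prop :=
  forall TH Th, admissible TH -> refines TH Th ->
  forall v w U, dspace Th v -> dspace TH w -> U `<=` TH `&` Th ->
  `|estimator Th U v - estimator TH U w| <= Cstab * hnorm (v - w).

Definition reduction (qred : R) : Prop :=
  forall TH Th, admissible TH -> refines TH Th ->
  forall v, dspace TH v ->
  estimator Th (Th `\` TH) v <= qred * estimator TH (TH `\` Th) v.

Definition reliability (Crel : R) : Prop :=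
  forall TH, admissible TH ->
  hnorm (exact_sol D - discrete_sol D TH) <= Crel * estimator TH TH (discrete_sol D TH).

Definition discrete_reliability (Crel : R) : Prop :=
  forall TH Th, admissible TH -> refines TH Th ->
  hnorm (discrete_sol D Th - discrete_sol D TH)
    <= Crel * estimator TH (TH `\` Th) (discrete_sol D TH).

(* The set of all [T] with #T - #T_0 <= N. The natural-number subtraction is
   truncated, which does not affect the comparison. *)
Definition meshes_upto (N : nat) : set {fset element D} :=
  [set T | admissible T /\ (#|` T| - #|` mesh0 D| <= N)%N]%classic.

Definition approx_norm (s : R) : \bar R :=
  ereal_sup (range (fun N : nat => ((N.+1%:R `^ s)%:E *
    ereal_inf [set (hnorm (exact_sol D - discrete_sol D T)
                 + estimator T T (discrete_sol D T))%:E
              | T in meshes_upto N])%E)).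

End Discretization.

Inductive contraction_kind := EnergyContraction | NormContraction.

Section Algorithm.
Context (R : realType) (k : scalars) (M : model R k) (D : discretization M).
Implicit Types (v w : M).

Definition contractive (c : contraction_kind) (qctr : R) : Prop :=
  forall (T : {fset element D}) v, admissible T -> dspace T v ->
  match c with
  | EnergyContraction => energy (solver T v) - energy (discrete_sol D T)
      <= qctr ^+ 2 * (energy v - energy (discrete_sol D T))
  | NormContraction => hnorm (discrete_sol D T - solver T v)
      <= qctr * hnorm (discrete_sol D T - v)
  end.

Definition distance (c : contraction_kind) w v : R :=
  match c with
  | EnergyContraction => Num.sqrt `|energy v - energy w|
  | NormContraction => hnorm (w - v)
  end.

(* [last_step l = None] means that the iteration on level [l] never stops.
   Values at levels and steps which are not reached are irrelevant. *)
Record run := Run {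
  mesh : nat -> {fset element D};
  marked : nat -> {fset element D};
  iterate : nat -> nat -> M;
  last_step : nat -> option nat
}.

Implicit Type r : run.

Definition level_reached r (l : nat) : Prop :=
  forall j, (j < l)%N -> last_step r j <> None.

Definition before_last r (l j : nat) : Prop :=
  if last_step r l is Some n then (j < n)%N else True.

Definition iterate_estimator r (l j : nat) : R :=
  estimator (mesh r l) (mesh r l) (iterate r l j).

Definition stopping c (lambda : R) r (l j : nat) : Prop :=
  distance c (iterate r l j) (iterate r l j.-1)
    <= lambda * iterate_estimator r l j.

Definition doerfler (theta : R) (T U : {fset element D}) v : Prop :=
  U `<=` T /\ theta * estimator T T v <= estimator T U v.

Definition adaptive_run c (theta lambda Cmark : R) r : Prop :=
  [/\ mesh r 0 = mesh0 D,
      dspace (mesh0 D) (iterate r 0 0),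
      forall l j, level_reached r l -> before_last r l j ->
        iterate r l j.+1 = solver (mesh r l) (iterate r l j),
      forall l, level_reached r l ->
        match last_step r l with
        | Some n => [/\ (0 < n)%N, stopping c lambda r l n &
            forall j, (0 < j < n)%N -> ~ stopping c lambda r l j]
        | None => forall j, (0 < j)%N -> ~ stopping c lambda r l j
        end &
      forall l n, level_reached r l -> last_step r l = Some n ->
        [/\ doerfler theta (mesh r l) (marked r l) (iterate r l n),
            forall U, doerfler theta (mesh r l) U (iterate r l n) ->
              #|` marked r l|%:R <= Cmark * #|` U|%:R,
            mesh r l.+1 = refine D (mesh r l) (marked r l) &
            iterate r l.+1 0 = iterate r l n]].

Definition indices r : set (nat * nat) :=
  [set p | level_reached r p.1 /\ before_last r p.1 p.2]%classic.

Definition index_lt (p q : nat * nat) : bool := ((p : (nat *l nat)%type) < q)%O.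
Definition index_le (p q : nat * nat) : bool := ((p : (nat *l nat)%type) <= q)%O.

Definition step_count r (p : nat * nat) : nat :=
  #|` fset_set [set q | indices r q /\ index_lt q p]%classic|.

Definition last_level r : \bar R :=
  ereal_sup [set (l%:R)%:E | l in [set l | indices r (l, 0%N)]]%classic.

Definition quasi_error r (p : nat * nat) : R :=
  hnorm (exact_sol D - iterate r p.1 p.2) + iterate_estimator r p.1 p.2.

Definition cumulative_cost r (p : nat * nat) : R :=
  \sum_(q \in [set q | indices r q /\ index_le q p]%classic)
    (#|` mesh r q.1|%:R : R).

Definition linear_convergence (Clin qlin : R) r : Prop :=
  forall p q, indices r p -> indices r q -> index_lt p q ->
  quasi_error r q
    <= Clin * qlin ^+ (step_count r q - step_count r p) * quasi_error r p.

Definition error_control c (Crel' : R) r : Prop :=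
  [/\ forall l j, level_reached r l -> (0 < j)%N ->
        (before_last r l j \/ last_step r l = Some j) ->
        quasi_error r (l, j) <= Crel' * (iterate_estimator r l j
          + distance c (iterate r l j) (iterate r l j.-1)),
      forall l n, level_reached r l -> last_step r l = Some n ->
        quasi_error r (l, n) <= Crel' * iterate_estimator r l n &
      forall l, level_reached r l.+1 ->
        quasi_error r (l.+1, 0%N)
          <= Crel' * estimator (mesh r l) (mesh r l) (iterate r l.+1 0)].

Definition zero_estimator_level r (l : nat) : Prop :=
  indices r (l.+1, 0%N) /\
  exists2 n, last_step r l = Some n & iterate_estimator r l n = 0.

(* The additional quantity on which the constant of the lower bound may
   depend: none in the generic case; the last level if there is one, or a level
   on which the final iterate has vanishing estimator. *)
Definition exceptional_level r (e : option nat) : Prop :=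
  match e with
  | None => last_level r = +oo%E /\ forall l, ~ zero_estimator_level r l
  | Some l => last_level r = (l%:R)%:E \/ zero_estimator_level r l
  end.

End Algorithm.

Definition lambda_opt (R : realType) (c : contraction_kind) (qctr Cstab alpha : R) : R :=
  match c with
  | NormContraction => (1 - qctr) / (qctr * Cstab)
  | EnergyContraction =>
      (1 - qctr) / (qctr * Cstab) * Num.sqrt (alpha / 2)
  end.

(* Main.v *)
Require Import Defs.
From HB Require Import structures.
From mathcomp Require Import all_boot all_order all_algebra finmap.
From mathcomp Require Import all_classical all_reals all_analysis.
From mathcomp Require Import complex ring lra zify.

Set Implicit Arguments.
Unset Strict Implicit.
Unset Printing Implicit Defensive.

Import Order.TTheory GRing.Theory Num.Theory.
Import numFieldNormedType.Exports.

Local Open Scope classical_set_scope.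
Local Open Scope ring_scope.

(** Write Delta for the quasi-error, eta for the estimator at the exact discrete
    solution, and C = Cstab * Crel.

    Lower bound. By quasi-optimality of Galerkin solutions ([cea]) and stability,
    the error of the exact discrete solution on the mesh of level l is at most a
    constant times Delta at any iterate of that level ([exact_error_le]). Fix a
    budget of N additional elements. If some level exceeds it, the last level
    within the budget realises the approximation rate, because a single
    refinement multiplies the number of elements by at most Cson. If no level
    exceeds it, either the solver never stops on some level, and linear
    convergence gives Delta -> 0 there, or some step marks nothing, and the
    estimator vanishes; in both cases a mesh within the budget has error zero
    ([mesh_exhausts]).

    Upper bound. The stopping criterion makes the final iterate of a level so
    close to the exact discrete solution that a set with the marking property for
    the latter and theta' has the marking property for the former and theta. By
    minimality of the marked set it suffices to exhibit a small set of the first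
    kind ([marking_cost]). Overlaying the current mesh T with a near-best mesh
    gives a refinement Th that reduces eta by a factor q and refines at most
    const * (B / (q eta))^(1/s) elements. These carry at least the
    fraction (1 - q (1 + 2 C)) / (1 + C^2) of eta^2 ([refined_fraction]).

    The constant has to be uniform as theta'^2 approaches 1 / (1 + C^2), so q
    cannot be tuned to theta'. Instead the defect of order q is made up for by the
    at most f * #T + 1 heaviest elements among the remaining ones, where f is
    proportional to q ([cheap_doerfler_set]). The number of marked elements on
    level j is then bounded by the optimal cost plus f * #T_j, and by the closure
    estimate #T_l is bounded by the sum of these over j < l. As the optimal cost
    grows geometrically in j by linear convergence, a discrete Gronwall argument
    absorbs the terms f * #T_j once f is small compared with 1 - qlin^(1/s)
    ([growth_bound], [mesh_le]). Summing the resulting bound over all earlier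
    steps is again a geometric series ([cumulative_cost_le]). *)

(** * Real and complex scalars *)

Section Scalars.
Context (R : realType) (k : scalars).
Implicit Types (x y z : scalar_field R k) (t : R).

Lemma scalar_reD x y : scalar_re (x + y) = scalar_re x + scalar_re y.
Proof. by case: k x y => // -[? ?] [? ?]. Qed.

Lemma scalar_reN x : scalar_re (- x) = - scalar_re x.
Proof. by case: k x => // -[]. Qed.

Lemma scalar_reB x y : scalar_re (x - y) = scalar_re x - scalar_re y.
Proof. by rewrite scalar_reD scalar_reN. Qed.

Lemma scalar_re0 : scalar_re (0 : scalar_field R k) = 0.
Proof. by case: k. Qed.

Lemma scalar_ofK t : scalar_re (scalar_of k t) = t.
Proof. by case: k. Qed.

Lemma scalar_ofD t u : scalar_of k (t + u) = scalar_of k t + scalar_of k u.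
Proof. by case: k => //=; exact: rmorphD. Qed.

Lemma scalar_of0 : scalar_of k 0 = 0 :> scalar_field R k.
Proof. by case: k => //=; exact: rmorph0. Qed.

Lemma scalar_of1 : scalar_of k 1 = 1 :> scalar_field R k.
Proof. by case: k => //=; exact: rmorph1. Qed.

Lemma scalar_ofV t : scalar_of k t^-1 = (scalar_of k t)^-1.
Proof. by case: k => //=; exact: (fmorphV (real_complex R)). Qed.

Lemma scalar_reM t z : scalar_re (scalar_of k t * z) = t * scalar_re z.
Proof. by case: k z => //= -[a b] /=; rewrite mul0r subr0. Qed.

Lemma ge0_scalar_of z : 0 <= z -> z = scalar_of k (scalar_re z).
Proof.
by case: k z => [z _ //|[a b]]; rewrite lecE /= => /andP[/eqP -> _].
Qed.

Lemma scalar_of_lt t u : (scalar_of k t < scalar_of k u) = (t < u).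
Proof. by case: k => //=; rewrite ltcR. Qed.

Lemma scalar_re_homo x y : x <= y -> scalar_re x <= scalar_re y.
Proof. by case: k x y => // -[a b] [c d]; rewrite lecE => /andP[]. Qed.

Lemma scalar_re_le_modulus z : scalar_re z <= modulus z.
Proof.
rewrite /modulus; case: k z => /= [z|z]; first exact: ler_norm.
rewrite (le_trans (ler_norm _))// -lecR.
rewrite (_ : (complex.Re `|z|)%:C%C = `|z|); first exact: normc_ge_Re.
by rewrite normc_def.
Qed.
End Scalars.

(** * The strongly monotone operator and its energy *)

Section HilbertNorm.
Context (R : realType) (k : scalars).
Context (H : completeNormedModType (scalar_field R k)).
Implicit Types (v w : H) (t : R).

Lemma norm_scalar v : `|v| = scalar_of k (hnorm v).
Proof. exact: ge0_scalar_of. Qed.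

Lemma hnorm_ge0 v : 0 <= hnorm v.
Proof. by rewrite -(scalar_re0 R k); exact: scalar_re_homo. Qed.

Lemma hnormD v w : hnorm (v + w) <= hnorm v + hnorm w.
Proof. by rewrite /hnorm -scalar_reD; apply: scalar_re_homo; exact: ler_normD. Qed.

Lemma hnormC v w : hnorm (v - w) = hnorm (w - v).
Proof. by rewrite /hnorm distrC. Qed.

Lemma hnorm_triangle u v w : hnorm (v - w) <= hnorm (v - u) + hnorm (u - w).
Proof. by rewrite (le_trans _ (hnormD _ _))// addrA subrK. Qed.

Lemma hnorm0_eq0 v : hnorm v = 0 -> v = 0.
Proof. by move=> v0; apply/eqP; rewrite -normr_eq0 norm_scalar v0 scalar_of0. Qed.

Lemma hnormZ t v : 0 <= t -> hnorm (scalar_of k t *: v) = t * hnorm v.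
Proof.
move=> t0; rewrite /hnorm normrZ ger0_norm ?scalar_reM//.
by case: k t t0 => //= t t0; rewrite lecR.
Qed.

(** Normalising v reduces the bound to the supremum over the unit ball. *)
Lemma dual_norm_bound (phi : H -> scalar_field R k) (c : R) v :
  (forall a x, phi (a *: x) = a * phi x) ->
  (dual_norm phi <= c%:E)%E -> scalar_re (phi v) <= c * hnorm v.
Proof.
move=> phiZ phic; have [v0|v0] := eqVneq (hnorm v) 0.
  by rewrite (hnorm0_eq0 v0) -(scale0r 0) phiZ mul0r scalar_re0 /hnorm scale0r
    normr0 scalar_re0 mulr0.
have vp : 0 < hnorm v by rewrite lt_def v0 hnorm_ge0.
set w := scalar_of k (hnorm v)^-1 *: v.
have w1 : hnorm w <= 1 by rewrite hnormZ ?invr_ge0 ?hnorm_ge0// mulVf.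
have : ((modulus (phi w))%:E <= c%:E)%E.
  by apply: le_trans phic; apply: ereal_sup_ubound; exists w.
rewrite lee_fin => /(le_trans (scalar_re_le_modulus _)).
by rewrite phiZ scalar_reM ler_pdivrMl// mulrC.
Qed.

End HilbertNorm.

Section Operator.
Context (R : realType) (k : scalars) (M : model R k).
Implicit Types (u v w : M) (X : set M).

Lemma dual_funD (phi : dual_space M) v w :
  phi (v + w) = phi v + phi w :> scalar_field R k.
Proof. exact: linearD. Qed.

Lemma dual_funZ (phi : dual_space M) a v :
  phi (a *: v) = a * phi v :> scalar_field R k.
Proof. exact: linearZ. Qed.

Lemma finite_dim_subspaceB X v w :
  finite_dim_subspace X -> X v -> X w -> X (v - w).
Proof.
move=> [n [e ->]] /= [a ->] [b ->]; exists (fun i => a i - b i).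
by rewrite -sumrB; apply: eq_bigr => i _; rewrite scalerBl.
Qed.

(** Galerkin orthogonality replaces the direction u - uX by u - v in the strong
    monotonicity estimate, and the Lipschitz bound does the rest. *)
Lemma cea (alpha L : R) X u uX v : 0 < alpha <= L ->
  strongly_monotone M alpha -> lipschitz_operator M L ->
  finite_dim_subspace X -> galerkin setT u -> galerkin X uX -> X v ->
  hnorm (u - uX) <= L / alpha * hnorm (u - v).
Proof.
move=> /andP[a0 aL] mono lip Xfin [_ uP] [XuX uXP] Xv.
have := mono uX u.
have -> : (operator u (u - uX) - operator uX (u - uX) : scalar_field R k) =
          operator u (u - v) - operator uX (u - v).
  have Xd : X (v - uX) by exact: finite_dim_subspaceB.
  have -> : u - uX = (u - v) + (v - uX) by rewrite addrA subrK.
  rewrite !(dual_funD _ (u - v)) (uP (v - uX))// (uXP (v - uX))//.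
  by rewrite opprD addrACA subrr addr0.
have Z a x : (operator u (a *: x) - operator uX (a *: x) : scalar_field R k) =
    a * (operator u x - operator uX x : scalar_field R k).
  by rewrite !dual_funZ mulrBr.
move=> /le_trans/(_ (dual_norm_bound (u - v) Z (lip uX u))).
have [->|d0] := eqVneq (hnorm (u - uX)) 0.
  by rewrite mulr_ge0 ?hnorm_ge0// divr_ge0// ltW// (lt_le_trans a0).
rewrite expr2 mulrA mulrAC [leRHS]mulrAC ler_pM2r ?lt_def ?d0 ?hnorm_ge0//.
by rewrite mulrAC ler_pdivlMr// mulrC.
Qed.

Lemma scalar_re_cvg (T : Type) (F : set_system T) (f : T -> scalar_field R k)
    (l : scalar_field R k) : Filter F ->
  f x @[x --> F] --> l -> scalar_re (f x) @[x --> F] --> scalar_re l.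
Proof.
move=> FF fl; apply/cvgrPdist_lt => e e0.
have e0' : 0 < scalar_of k e by rewrite -(scalar_of0 R k) scalar_of_lt.
move/cvgrPdist_lt : fl => /(_ _ e0'); apply: filterS => x lfe.
have {}lfe : scalar_re `|l - f x| < e.
  by move: lfe; rewrite (ge0_scalar_of (normr_ge0 (l - f x))) scalar_ofK scalar_of_lt.
rewrite -scalar_reB (le_lt_trans _ lfe)// ler_norml.
apply/andP; split; last exact: scalar_re_le_modulus.
by rewrite lerNl -scalar_reN (le_trans (scalar_re_le_modulus _))// /modulus normrN.
Qed.

Let segment u w (t : R) := u + scalar_of k t *: w.

Lemma derive_energy u w (t : R) :
  is_derive t 1 (fun t => energy (segment u w t))
    (scalar_re (operator (segment u w t) w - rhs M w : scalar_field R k)).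
Proof.
set l := (X in is_derive _ _ _ X).
suff cl : h^-1 *: (((fun t => energy (segment u w t)) \o shift t) (h *: (1:R)) -
   energy (segment u w t)) @[h --> (0:R)^'] --> l.
  apply: DeriveDef; first by apply/cvg_ex; exists l.
  exact: cvg_lim cl.
rewrite {}/l scalar_reB.
pose P := potential (m := M).
pose F v := scalar_re (rhs M v : scalar_field R k).
pose z := segment u w t.
have sP h : segment u w (h *: 1 + t) = z + scalar_of k h *: w.
  by rewrite /z /segment scalar_ofD scalerDl addrA addrAC [h *: 1]mulr1.
apply: (@cvg_trans _ ((scalar_re ((P (z + scalar_of k h *: w) - P z) / scalar_of k h)
    - F w) @[h --> (0:R)^'])).
  apply: near_eq_cvg; near=> h.
  have h0 : h != 0 by near: h; exact: nbhs_dnbhs_neq.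
  rewrite /= sP /energy -scalar_ofV mulrC scalar_reM !scalar_reB.
  rewrite dual_funD dual_funZ scalar_reD scalar_reM.
  rewrite [RHS](_ : _ = h^-1 * (scalar_re (P (z + scalar_of k h *: w))
    - (F z + h * F w) - (scalar_re (P z) - F z)))//.
  by field.
apply: cvgB; last exact: cvg_cst.
apply: scalar_re_cvg.
exact: (@operatorP _ _ M (segment u w t) w).
Unshelve. all: by end_near.
Qed.

(** Along the segment from u to v the energy has derivative zero at u, by the
    Galerkin equation tested with v - u, and strong monotonicity makes the
    derivative grow at least like alpha * t * ||v - u||^2. Hence the energy minus
    the integral of this lower bound does not decrease. *)
Lemma energy_lower_bound (alpha : R) X u v :
  strongly_monotone M alpha -> finite_dim_subspace X ->
  galerkin X u -> X v ->
  alpha / 2 * hnorm (v - u) ^+ 2 <= energy v - energy u.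
Proof.
move=> mono Xfin [Xu uP] Xv; set w := v - u.
have Xw : X w by exact: finite_dim_subspaceB.
pose a := alpha / 2 * hnorm w ^+ 2.
pose l t := scalar_re (operator (segment u w t) w - rhs M w : scalar_field R k).
pose psi t := energy (segment u w t) - a * t ^+ 2.
have dpsi (t : R) : is_derive t 1 psi (l t - a * (2 * t)).
  have de := derive_energy u w t.
  apply: is_derive_eq.
  by rewrite /GRing.scale/= mulr1 mulr2n mulrDl mul1r.
have [|c] := @MVT _ psi (fun t => l t - a * (2 * t)) 0 1 ltr01.
  apply: derivable_within_continuous => t _.
  exact: (@ex_derive _ _ _ _ _ _ _ (dpsi t)).
rewrite in_itv/= => /andP[c0 c1] psiE.
have : 0 <= psi 1 - psi 0.
  rewrite psiE subr0 mulr1 subr_ge0.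
  have := mono u (segment u w c).
  rewrite /segment addrAC subrr add0r hnormZ ?(ltW c0)// !dual_funZ -mulrBr.
  rewrite scalar_reM exprMn expr2 -mulrA mulrCA ler_pM2l// => mc.
  by rewrite /l /segment -(uP _ Xw); rewrite /a; lra.
rewrite /psi /segment scalar_of1 scalar_of0 scale1r scale0r addr0.
rewrite /w addrCA subrr addr0 -/w -/a; lra.
Qed.
End Operator.

(** * Selecting heavy elements of a finite set *)

Local Open Scope fset_scope.
Local Open Scope ring_scope.

Section FiniteSelection.
Context (R : realType) (E : choiceType).
Implicit Types (U S : {fset E}) (w : E -> R).

Lemma sum_fsetID U W w :
  \sum_(x <- U) w x = \sum_(x <- U `&` W) w x + \sum_(x <- U `\` W) w x.
Proof.
rewrite (big_fsetID _ (mem W)); congr (_ + _); apply: eq_fbigl => x;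
  by rewrite !inE// andbC.
Qed.

Lemma le_average U w : U != fset0 ->
  exists2 x, x \in U & #|` U|%:R * w x <= \sum_(y <- U) w y.
Proof.
move=> U0; apply: contrapT => /forall2NP h.
have lt x : x \in U -> \sum_(y <- U) w y < #|` U|%:R * w x.
  by move=> xU; case: (h x) => [/negP|/negP]; rewrite ?xU// -ltNge.
have : \sum_(x <- U) (\sum_(y <- U) w y) < \sum_(x <- U) (#|` U|%:R * w x).
  rewrite big_seq [ltRHS]big_seq; apply: ltr_sum => //.
  by case/fset0Pn : U0 => x xU; apply/hasP; exists x.
by rewrite -mulr_sumr big_const_seq count_predT iter_addr_0 mulr_natl ltxx.
Qed.

(** Keeping the heaviest elements: dropping an element of at most average
    weight never lowers the average of the remaining ones. *)
Lemma heavy_subset U w (m : nat) : (forall x, x \in U -> 0 <= w x) ->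
  (m <= #|` U|)%N -> exists S, [/\ S `<=` U, #|` S| = m &
    m%:R * \sum_(x <- U) w x <= #|` U|%:R * \sum_(x <- S) w x].
Proof.
move=> w0; elim: {m}(#|` U| - m)%N {-2}m (erefl (#|` U| - m)%N) => [|d IH] m dE mU.
  have mE : m = #|` U| by lia.
  by exists U; split; rewrite ?mE ?fsubset_refl.
have [||S [SU Sm SE]] := IH m.+1; try lia.
have S0 : S != fset0 by rewrite -cardfs_gt0 Sm.
have [x xS xw] := le_average w S0.
exists (S `\ x); split.
- by rewrite (fsubset_trans _ SU)// fsubD1set.
- by have := cardfsD1 x S; rewrite xS Sm => -[].
have [->|m0] := posnP m.
  rewrite mul0r mulr_ge0// big_seq sumr_ge0// => y /fsetD1P[_ yS].
  by rewrite w0// (fsubsetP SU).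
rewrite (big_fsetD1 x)//= in xw SE.
rewrite Sm in xw.
have U0 : 0 <= #|` U|%:R :> R by [].
have M0 : 0 < m.+1%:R :> R by rewrite ltr0n.
rewrite -(ler_pM2l M0).
apply: (@le_trans _ _ (m%:R * (#|` U|%:R * (w x + \sum_(i <- S `\ x) w i)))).
  by rewrite mulrCA ler_wpM2l.
move: U0 xw; rewrite -natr1; set a := #|` U|%:R; set b := \sum_(_ <- _) _.
move=> a0 h; nra.
Qed.

Lemma heavy_fraction U w (f : R) : (forall x, x \in U -> 0 <= w x) ->
  0 <= f <= 1 -> exists S, [/\ S `<=` U, #|` S|%:R <= f * #|` U|%:R + 1 &
    f * \sum_(x <- U) w x <= \sum_(x <- S) w x].
Proof.
move=> w0 /andP[f0 f1].
have fU0 : 0 <= f * #|` U|%:R by rewrite mulr_ge0.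
have [->|U0] := eqVneq U fset0.
  exists fset0; split; rewrite ?fsubset_refl// ?cardfs0 ?mulr0 ?add0r//.
  by rewrite big_seq_fset0 mulr0.
have Up : 0 < #|` U|%:R :> R by rewrite ltr0n cardfs_gt0.
have s0 : 0 <= \sum_(x <- U) w x by rewrite big_seq sumr_ge0.
(* The least integer above f * #U, cut off at #U. *)
pose m := minn #|` U| (Num.truncn (f * #|` U|%:R)).+1.
have [|S [SU Sm SE]] := heavy_subset (m := m) w0; first exact: geq_minl.
exists S; split => //.
  rewrite Sm (@le_trans _ _ (Num.truncn (f * #|` U|%:R)).+1%:R)//.
    by rewrite ler_nat geq_minr.
  by rewrite -natr1 lerD2r truncn_le.
rewrite -(ler_pM2l Up) (le_trans _ SE)// mulrA ler_wpM2r// mulrC.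
rewrite /m; case: leqP => _.
  by rewrite ler_piMl.
by rewrite ltW// truncnS_gt.
Qed.

End FiniteSelection.

(** * Meshes and the error estimator *)

Section Meshes.
Context (R : realType) (k : scalars) (M : model R k) (D : discretization M).
Implicit Types (T TH Th U W : {fset element D}) (v w : M).

Lemma refines_trans T TH Th : refines TH Th -> refines T TH -> refines T Th.
Proof.
elim=> [//|T' m _ IH mT' TTH]; exact: refinement_step (IH TTH) mT'.
Qed.

Lemma admissible_refines T Th : admissible T -> refines T Th -> admissible Th.
Proof. by move=> aT TTh; exact: refines_trans TTh aT. Qed.

(** The one-step estimates telescope, because an element of T that is missing in
    Th has been removed in one of the steps. *)
Lemma card_refines (Cson : R) T Th : son_estimate D Cson ->
  admissible T -> refines T Th -> (#|` T `\` Th| + #|` T| <= #|` Th|)%N.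
Proof.
move=> son aT; elim=> [|T' m TT' IH mT']; first by rewrite fsetDv cardfs0.
have [+ _] := son T' m (admissible_refines aT TT') mT'.
set Th' := refine D T' m => h.
have /fsubset_leq_card : T `\` Th' `<=` (T `\` T') `|` (T' `\` Th').
  by apply/fsubsetP => x; rewrite !inE => /andP[-> ->]; case: (x \in T').
by have [] := leq_card_fsetU (T `\` T') (T' `\` Th'); lia.
Qed.

Lemma card_refines_le (Cson : R) T Th : son_estimate D Cson ->
  admissible T -> refines T Th -> (#|` T| <= #|` Th|)%N.
Proof. by move=> son aT /(card_refines son aT); lia. Qed.

Lemma card_refine_le (Cson : R) T m : 1 <= Cson -> son_estimate D Cson ->
  admissible T -> m `<=` T -> #|` refine D T m|%:R <= Cson * #|` T|%:R.
Proof.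
move=> C1 son aT mT; have [_ /le_trans] := son T m aT mT; apply.
rewrite -[in leRHS](cardfsID (refine D T m) T) natrD mulrDr addrC lerD2r.
by rewrite ler_peMl.
Qed.

Lemma admissible_mesh0 : admissible (mesh0 D).
Proof. exact: refinement_refl. Qed.

Lemma estimator_ge0 T U v : 0 <= estimator T U v.
Proof. exact: sqrtr_ge0. Qed.

Lemma estimator_sqr T U v : estimator T U v ^+ 2 = \sum_(t <- U) estim T t v ^+ 2.
Proof. by rewrite sqr_sqrtr// sumr_ge0// => t _; rewrite sqr_ge0. Qed.

Lemma estimator0 T v : estimator T fset0 v = 0.
Proof. by rewrite /estimator big_seq_fset0 sqrtr0. Qed.

Lemma estimator_split T U W v : estimator T U v ^+ 2 =
  estimator T (U `&` W) v ^+ 2 + estimator T (U `\` W) v ^+ 2.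
Proof. by rewrite !estimator_sqr -sum_fsetID. Qed.

Lemma estimator_mono T U W v : U `<=` W -> estimator T U v <= estimator T W v.
Proof.
move=> UW; rewrite -ler_sqr ?nnegrE ?estimator_ge0//.
by rewrite (estimator_split _ W U) (fsetIidPr UW) lerDl sqr_ge0.
Qed.

Section Estimates.
Context (Cstab Crel qred : R).
Context (Cstab0 : 0 < Cstab) (stab : stability D Cstab).

Lemma estimator_stable T U v w : admissible T -> U `<=` T ->
  dspace T v -> dspace T w ->
  estimator T U v <= estimator T U w + Cstab * hnorm (v - w).
Proof.
move=> aT UT Tv Tw; rewrite -lerBlDl (le_trans (ler_norm _))//.
by apply: stab => //; [exact: refinement_refl|rewrite fsetIid].
Qed.

Context (Crel0 : 0 < Crel) (drel : discrete_reliability D Crel).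

(** On elements common to both meshes only stability is at work, and the distance of
    the two discrete solutions is controlled by the refined elements. *)
Lemma estimator_common T Th : admissible T -> refines T Th ->
  estimator T (T `&` Th) (discrete_sol D T) <=
  estimator Th (T `&` Th) (discrete_sol D Th)
  + Cstab * Crel * estimator T (T `\` Th) (discrete_sol D T).
Proof.
move=> aT TTh; have aTh := admissible_refines aT TTh.
rewrite -lerBlDl (le_trans (ler_norm _))// distrC.
rewrite (le_trans (stab aT TTh (discrete_solP aTh).1 (discrete_solP aT).1 _))//.
by rewrite -mulrA ler_pM2l//; exact: drel.
Qed.

(** For a fixed discrete function, stability identifies the contributions of the
    common elements, and the contribution of the refined elements decreases. *)
Lemma estimator_coarse (q1 : 0 < qred < 1) (red : reduction D qred) T Th v :
  admissible T -> refines T Th -> dspace T v ->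
  estimator Th Th v <= estimator T T v.
Proof.
move=> aT TTh Tv; have aTh := admissible_refines aT TTh.
have Thv : dspace Th v by exact: dspace_nested TTh _ Tv.
rewrite -ler_sqr ?nnegrE ?estimator_ge0// (estimator_split _ Th T).
rewrite (estimator_split _ T Th) fsetIC lerD//.
  rewrite ler_sqr ?nnegrE ?estimator_ge0//.
  have := stab aT TTh Thv Tv (fsubset_refl _).
  rewrite subrr /hnorm normr0 scalar_re0 mulr0 normr_le0 subr_eq0 => /eqP.
  by move=> ->.
have [q0 ql1] := andP q1.
rewrite ler_sqr ?nnegrE ?estimator_ge0// (le_trans (red _ _ aT TTh _ Tv))//.
by rewrite ler_piMl ?estimator_ge0// ltW.
Qed.

(** The solution on T serves as a competitor on Th: there its estimator has not
    increased, and discrete reliability bounds the distance to the solution on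
    Th by the estimator on T. *)
Lemma quasi_monotonicity (q1 : 0 < qred < 1) (red : reduction D qred) T Th :
  admissible T -> refines T Th ->
  estimator Th Th (discrete_sol D Th) <=
  (1 + Cstab * Crel) * estimator T T (discrete_sol D T).
Proof.
move=> aT TTh; have aTh := admissible_refines aT TTh.
have Tu := (discrete_solP aT).1; have Thu := (discrete_solP aTh).1.
have ThuT : dspace Th (discrete_sol D T) by exact: dspace_nested TTh _ Tu.
rewrite (le_trans (estimator_stable aTh (fsubset_refl _) Thu ThuT))//.
rewrite mulrDl mul1r lerD ?estimator_coarse// -mulrA ler_pM2l//.
rewrite (le_trans (drel aT TTh))// ler_pM2l// estimator_mono//.
exact: fsubsetDl.
Qed.

(** With eta the estimator on T, r the contribution of the refined elements and
    C = Cstab * Crel, the contribution of the common elements is at most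
    q * eta + C * r by [estimator_common]. So eta^2 <= r^2 + (q * eta + C * r)^2, and
    the terms containing q are at most q * (1 + 2 * C) * eta^2. *)
Lemma refined_fraction T Th q : admissible T -> refines T Th -> 0 <= q <= 1 ->
  estimator Th Th (discrete_sol D Th) <= q * estimator T T (discrete_sol D T) ->
  (1 - q * (1 + 2 * (Cstab * Crel))) * estimator T T (discrete_sol D T) ^+ 2 <=
  (1 + (Cstab * Crel) ^+ 2) * estimator T (T `\` Th) (discrete_sol D T) ^+ 2.
Proof.
move=> aT TTh /andP[q0 q1] hq.
have := estimator_common aT TTh.
have := estimator_mono Th (discrete_sol D Th) (fsubsetIr T Th).
have := estimator_split T T Th (discrete_sol D T).
have := estimator_mono T (discrete_sol D T) (fsubsetDl T Th).
have C0 : 0 < Cstab * Crel by rewrite mulr_gt0.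
move: hq C0 (estimator_ge0 T (T `&` Th) (discrete_sol D T)).
move: (estimator_ge0 T (T `\` Th) (discrete_sol D T)).
set eta := estimator T T _; set r := estimator T (T `\` Th) _.
set y := estimator T _ _; set C := Cstab * Crel.
set z := estimator Th _ _; set z' := estimator Th _ _.
move=> r0 hz C0 y0 reta E z'z yz.
have eta0 : 0 <= eta by exact: le_trans reta.
have {}yz : y <= q * eta + C * r by lra.
have qeta0 : 0 <= q * eta by exact: mulr_ge0.
have Cr0 : 0 <= C * r by rewrite mulr_ge0// ltW.
have : y ^+ 2 <= (q * eta + C * r) ^+ 2 by rewrite ler_sqr// nnegrE addr_ge0.
have h1 : q * eta * (C * r) <= q * eta * (C * eta).
  by apply: ler_wpM2l; [done|exact: ler_wpM2l (ltW C0) _ _ reta].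
have h2 : q * (q * eta ^+ 2) <= 1 * (q * eta ^+ 2).
  by apply: ler_wpM2r => //; rewrite mulr_ge0// sqr_ge0.
rewrite !expr2 in h2 E *; lra.
Qed.

End Estimates.
End Meshes.

(** * Small sets with the marking property *)

Section CheapSets.
Context (R : realType) (k : scalars) (M : model R k) (D : discretization M).
Implicit Types (T TH Th U W : {fset element D}) (v w : M).

Lemma powR_rootK (x s : R) : 0 <= x -> 0 < s -> (x `^ s^-1) `^ s = x.
Proof. by move=> x0 s0; rewrite -powRrM mulVf ?powRr1// gt_eqF. Qed.

(** With N the integer part of (B / t)^(1/s), t * (N + 1)^s exceeds B, hence the
    infimum over the meshes with at most N additional elements is below t. *)
Lemma near_best_mesh (s B t : R) : 0 < s -> 0 <= B -> 0 < t ->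
  (approx_norm D s <= B%:E)%E ->
  exists T, [/\ admissible T,
    (#|` T| - #|` mesh0 D|)%N%:R <= (B / t) `^ s^-1 &
    estimator T T (discrete_sol D T) <= t].
Proof.
move=> s0 B0 t0 AB; have Bt0 : 0 <= B / t by rewrite divr_ge0// ltW.
set x := (B / t) `^ s^-1; pose N := Num.truncn x.
have x0 : 0 <= x by exact: powR_ge0.
have Nx : N%:R <= x by rewrite truncn_le.
have xN : x < N.+1%:R by rewrite truncnS_gt.
have BN : B < N.+1%:R `^ s * t.
  rewrite -ltr_pdivrMr// -[ltLHS](powR_rootK Bt0 s0) gt0_ltr_powR// ?nnegrE//.
set I := ereal_inf [set (hnorm (exact_sol D - discrete_sol D T)
                 + estimator T T (discrete_sol D T))%:E
              | T in meshes_upto N].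
have NI : ((N.+1%:R `^ s)%:E * I <= B%:E)%E.
  by apply: le_trans AB; apply: ereal_sup_ubound; exists N.
have : (I < t%:E)%E.
  rewrite ltNge; apply/negP => tI; move: NI; apply/negP; rewrite -ltNge.
  apply: (@lt_le_trans _ _ (N.+1%:R `^ s * t)%:E); first by rewrite lte_fin.
  by rewrite EFinM lee_wpmul2l// lee_fin powR_ge0.
move=> /ereal_inf_lt[_ [T [aT TN] <-]]; rewrite lte_fin => /ltW h.
exists T; split => //; first by rewrite (le_trans _ Nx)// ler_nat.
by apply: le_trans h; rewrite lerDr hnorm_ge0.
Qed.

(** U collects the elements refined in the overlay with a near-best mesh and the
    heaviest elements among the others. With C = Cstab * Crel, the former carry the
    fraction 1 / (1 + C^2) of the squared estimator up to a defect proportional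
    to q, and the latter the fraction f of the remainder, whose share is about
    C^2 / (1 + C^2); the condition relating q and f says that this covers the
    defect. So q and f can be chosen before theta'. *)
Lemma cheap_doerfler_set (Cson Cstab Crel qred s B f q theta' : R) T :
  son_estimate D Cson -> overlay_estimate D ->
  0 < Cstab -> stability D Cstab -> 0 < qred < 1 -> reduction D qred ->
  0 < Crel -> discrete_reliability D Crel ->
  0 < s -> 0 <= B -> (approx_norm D s <= B%:E)%E ->
  0 <= f <= 1 -> 0 < q <= 1 ->
  q * (1 + 2 * (Cstab * Crel)) <= f * (Cstab * Crel) ^+ 2 ->
  0 <= theta' -> theta' ^+ 2 * (1 + (Cstab * Crel) ^+ 2) <= 1 ->
  admissible T -> 0 < estimator T T (discrete_sol D T) ->
  exists U, [/\ U `<=` T,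
    theta' * estimator T T (discrete_sol D T) <= estimator T U (discrete_sol D T) &
    #|` U|%:R <= (B / (q / (1 + Cstab * Crel) * estimator T T (discrete_sol D T)))
      `^ s^-1 + 1 + f * #|` T|%:R].
Proof.
set C := Cstab * Crel; set eta := estimator T T _.
move=> son ovl Cstab0 stab q1 red Crel0 drel s0 B0 AB /andP[f0 f1] /andP[q0 ql1].
move=> qf th0 th1 aT eta0.
have C0 : 0 < C by rewrite mulr_gt0.
have t0 : 0 < q / (1 + C) * eta by rewrite mulr_gt0// divr_gt0// addr_gt0.
have [Topt [aTopt cTopt eTopt]] := near_best_mesh s0 B0 t0 AB.
have [Th [TTh ToptTh cTh]] := ovl _ _ _ (admissible_mesh0 D) aT aTopt.
have aTh := admissible_refines aT TTh.
have hq : estimator Th Th (discrete_sol D Th) <= q * eta.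
  rewrite (le_trans (quasi_monotonicity Cstab0 stab Crel0 drel q1 red aTopt ToptTh))//.
  rewrite -ler_pdivlMl ?addr_gt0// (le_trans eTopt)//.
  by rewrite mulrA [_ / _]mulrC.
have q01 : 0 <= q <= 1 by rewrite ltW.
have := refined_fraction Cstab0 stab Crel0 drel aT TTh q01 hq.
rewrite -/eta -/C; set r := estimator T (T `\` Th) _ => hr.
have w0 : forall x, x \in T `&` Th -> 0 <= estim T x (discrete_sol D T) ^+ 2.
  by move=> x _; rewrite sqr_ge0.
have [|S [STTh cS hS]] := heavy_fraction (f := f) w0; first by rewrite f0.
exists ((T `\` Th) `|` S); split.
- rewrite fsubUset fsubsetDl (fsubset_trans STTh)//; exact: fsubsetIl.
- rewrite -ler_sqr ?nnegrE ?estimator_ge0 ?mulr_ge0 ?(ltW eta0)// exprMn.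
  have -> : estimator T (T `\` Th `|` S) (discrete_sol D T) ^+ 2 =
      r ^+ 2 + \sum_(x <- S) estim T x (discrete_sol D T) ^+ 2.
    have SE : (T `\` Th `|` S) `\` (T `\` Th) = S.
      apply/fsetP => x; rewrite !inE; have := fsubsetP STTh x; rewrite !inE.
      by case: (x \in S) => //=; case: (x \in Th); case: (x \in T) => //= /(_ isT).
    by rewrite (estimator_split _ _ (T `\` Th)) (fsetIidPr (fsubsetUl _ _)) SE
      [X in _ + X]estimator_sqr.
    apply: (le_trans _ (lerD (lexx (r ^+ 2)) hS)).
  rewrite -estimator_sqr.
  have := estimator_split T T Th (discrete_sol D T).
  rewrite -/eta -/r => E.
  have Cp : 0 < 1 + C ^+ 2 by rewrite addr_gt0// exprn_gt0.
  rewrite -(ler_pM2r Cp) mulrAC.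
  apply: (@le_trans _ _ (eta ^+ 2)); first by rewrite ler_piMl// sqr_ge0.
  (* The new set carries f * eta^2 + (1 - f) * r^2, to which the lower bound for r
     is applied. *)
  have fr : (1 - f) * ((1 - q * (1 + 2 * C)) * eta ^+ 2) <=
      (1 - f) * ((1 + C ^+ 2) * r ^+ 2).
    by rewrite ler_wpM2l// subr_ge0.
  have := ler_wpM2r (sqr_ge0 eta) qf.
  have : 0 <= f * (q * (1 + 2 * C)) * eta ^+ 2.
    rewrite mulr_ge0 ?sqr_ge0// mulr_ge0// mulr_ge0 ?(ltW q0)//.
    by rewrite addr_ge0// mulr_ge0// ltW.
  have -> : estimator T (T `&` Th) (discrete_sol D T) ^+ 2 = eta ^+ 2 - r ^+ 2.
    by rewrite E addrK.
  move: fr; rewrite !expr2; lra.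
- have cU := (leq_card_fsetU (T `\` Th) S).1.
  apply: (@le_trans _ _ (#|` T `\` Th|%:R + #|` S|%:R)).
    by rewrite -natrD ler_nat.
  have c1 := card_refines son aT TTh.
  have c2 := card_refines_le son (admissible_mesh0 D) aTopt.
  have cSle : f * #|` T `&` Th|%:R <= f * #|` T|%:R.
    by rewrite ler_wpM2l// ler_nat fsubset_leq_card// fsubsetIl.
  move: cTopt cTh; rewrite natrB// => cTopt cTh.
  have : #|` T `\` Th|%:R + #|` T|%:R <= #|` Th|%:R :> R by rewrite -natrD ler_nat.
  by lra.
Qed.
End CheapSets.

(** * The index set of the algorithm *)

Section Indices.
Context (R : realType) (k : scalars) (M : model R k) (D : discretization M).
Context (r : run D).
Implicit Types (p q : nat * nat).

Lemma index_leE p q :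
  index_le p q = (p.1 < q.1)%N || (p.1 == q.1) && (p.2 <= q.2)%N.
Proof.
case: p q => [a b] [c d]; rewrite /index_le Order.ProdLexiOrder.lexi_pair/=.
by rewrite !leEnat; case: ltngtP.
Qed.

Lemma index_ltE p q :
  index_lt p q = (p.1 < q.1)%N || (p.1 == q.1) && (p.2 < q.2)%N.
Proof.
case: p q => [a b] [c d]; rewrite /index_lt Order.ProdLexiOrder.ltxi_pair/=.
by rewrite !leEnat ltEnat; case: ltngtP.
Qed.

Lemma index_le_eqVlt p q : index_le p q = (p == q) || index_lt p q.
Proof.
rewrite index_leE index_ltE; case: p q => [a b] [c d] /=.
by rewrite xpair_eqE; lia.
Qed.

Lemma index_lt_trans p q q' : index_lt p q -> index_lt q q' -> index_lt p q'.
Proof. by rewrite !index_ltE; lia. Qed.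

Lemma level_reached_le i j : (i <= j)%N -> level_reached r j -> level_reached r i.
Proof. by move=> ij rj l li; apply: rj; exact: leq_trans ij. Qed.

Lemma level_reachedS l : level_reached r l -> last_step r l <> None ->
  level_reached r l.+1.
Proof. by move=> rl nl j; rewrite ltnS leq_eqVlt => /predU1P[->//|]; exact: rl. Qed.

(** The levels before that of p have all stopped, which bounds the step numbers
    that occur on them. *)
Lemma indices_le_finite p : indices r p ->
  finite_set [set q | indices r q /\ index_le q p]%classic.
Proof.
move=> [rp _].
pose K := (p.2 + \sum_(j < p.1) odflt 0 (last_step r j))%N.
apply: (@sub_finite_set _ _ (`I_p.1.+1 `*` `I_K.+1)%classic); last first.
  by apply: finite_setX; exact: finite_II.
move=> q [[rq bq]]; rewrite index_leE => /orP[lt|/andP[/eqP e le]]; split => /=.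
- by rewrite ltnS ltnW.
- have := rp _ lt; move: bq; rewrite /before_last.
  case E: (last_step r q.1) => [n|]// qn _.
  rewrite ltnS (leq_trans (ltnW qn))// (leq_trans _ (leq_addl _ _))//.
  by rewrite (bigD1 (Ordinal lt))//= E leq_addr.
- by rewrite ltnS e.
- by rewrite ltnS (leq_trans le)// leq_addr.
Qed.

Lemma indices_lt_finite p : indices r p ->
  finite_set [set q | indices r q /\ index_lt q p]%classic.
Proof.
move=> /indices_le_finite; apply: sub_finite_set => q /= [iq qp]; split => //.
by rewrite index_le_eqVlt qp orbT.
Qed.

Lemma step_count_lt p q : indices r p -> indices r q -> index_lt p q ->
  (step_count r p < step_count r q)%N.
Proof.
move=> ip iq pq; apply: fproper_ltn_card.
have fp := indices_lt_finite ip; have fq := indices_lt_finite iq.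
rewrite fproperE; apply/andP; split.
  apply/fsubsetP => x; rewrite !in_fset_set// !inE => -[ix xp]; split => //.
  exact: index_lt_trans pq.
apply/negP => /fsubsetP/(_ p); rewrite !in_fset_set// !inE.
by move=> /(_ (conj ip pq)) [_]; rewrite index_ltE; lia.
Qed.

Lemma step_count_inj p q : indices r p -> indices r q ->
  step_count r p = step_count r q -> p = q.
Proof.
move=> ip iq e; apply/eqP; apply: contraT => npq.
have : index_lt p q || index_lt q p.
  move: npq; rewrite !index_ltE; case: p q {ip iq e} => [a b] [c d].
  by rewrite xpair_eqE /=; lia.
by case/orP => /step_count_lt h; [have := h ip iq|have := h iq ip]; rewrite e ltnn.
Qed.

Lemma before_last_le l i j : (i <= j)%N -> before_last r l j -> before_last r l i.
Proof. by rewrite /before_last; case: last_step => // n ij; exact: leq_ltn_trans. Qed.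

Lemma step_count_inner l j : indices r (l, j) ->
  (step_count r (l, 0) + j <= step_count r (l, j))%N.
Proof.
elim: j => [|j IH] ij; first by rewrite addn0.
have ij' : indices r (l, j) by case: ij => ? bj; split => //; exact: before_last_le bj.
have := IH ij'; have := step_count_lt ij' ij.
by rewrite index_ltE/= ltnn eqxx ltnS leqnn => /(_ isT); lia.
Qed.

Context (c : contraction_kind) (theta lambda Cmark : R).
Context (rP : adaptive_run c theta lambda Cmark r).

Lemma level_start l : level_reached r l -> indices r (l, 0).
Proof.
move=> rl; split => //; rewrite /before_last/=.
by case: rP => _ _ _ /(_ l rl) + _; case: last_step => // n [].
Qed.

(** Each level contributes at least its initial index. *)
Lemma step_count_levels i j : (i <= j)%N -> level_reached r j ->
  (step_count r (i, 0) + (j - i) <= step_count r (j, 0))%N.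
Proof.
move=> ij; rewrite -{1 3}(subnK ij); elim: (j - i)%N => [|n IH] rn.
  by rewrite add0n addn0.
have rn' : level_reached r (n + i) by apply: level_reached_le rn; lia.
have lt : index_lt (n + i, 0)%N (n.+1 + i, 0)%N by rewrite index_ltE/= addSn ltnSn.
rewrite addnS; apply: leq_ltn_trans (IH rn') _.
exact: step_count_lt (level_start rn') (level_start rn) lt.
Qed.

Lemma level_step l : level_reached r l.+1 -> exists n,
  [/\ last_step r l = Some n, (0 < n)%N, level_reached r l,
    [/\ doerfler theta (mesh r l) (marked r l) (iterate r l n),
        forall U, doerfler theta (mesh r l) U (iterate r l n) ->
          #|` marked r l|%:R <= Cmark * #|` U|%:R,
        mesh r l.+1 = refine D (mesh r l) (marked r l) &
        iterate r l.+1 0 = iterate r l n] &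
    stopping c lambda r l n].
Proof.
move=> rl1; have rl := level_reached_le (leqnSn l) rl1.
have := rl1 l (ltnSn l); case E: (last_step r l) => [n|]// _.
case: rP => _ _ _ /(_ l rl); rewrite E => -[n0 st _] /(_ l n rl E) h.
by exists n; split.
Qed.

Lemma mesh_admissible l : level_reached r l -> admissible (mesh r l).
Proof.
elim: l => [_|l IH rl1]; first by case: rP => -> *; exact: admissible_mesh0.
have [n [_ _ rl [[mT _] _ -> _] _]] := level_step rl1.
exact: refinement_step (IH rl) mT.
Qed.

Lemma mesh_refinesS l : level_reached r l.+1 -> refines (mesh r l) (mesh r l.+1).
Proof.
move=> rl1; have [n [_ _ rl [[mT _] _ -> _] _]] := level_step rl1.
by apply: refinement_step mT; exact: refinement_refl.
Qed.

Lemma iterate_dspace l j : level_reached r l ->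
  (before_last r l j \/ last_step r l = Some j) -> dspace (mesh r l) (iterate r l j).
Proof.
elim: l j => [|l IH] j rl.
  elim: j => [_|j IHj hj]; first by case: rP => -> *.
  have bj : before_last r 0 j.
    by rewrite /before_last; case: hj => [/before_last_le|->//]; exact.
  have [m0 _ itS _ _] := rP; rewrite itS//.
  by apply: solver_dspace; [exact: mesh_admissible|apply: IHj; left].
elim: j => [_|j IHj hj].
  have [n [ln _ rl' [_ _ _ ->] _]] := level_step rl.
  apply: dspace_nested (mesh_refinesS rl) _ _; first exact: mesh_admissible.
  by apply: IH => //; right.
have bj : before_last r l.+1 j.
  by rewrite /before_last; case: hj => [/before_last_le|->//]; exact.
have [m0 _ itS _ _] := rP; rewrite itS//.
by apply: solver_dspace; [exact: mesh_admissible|apply: IHj; left].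
Qed.

End Indices.

(** * Solver error and the number of marked elements *)

Section Solver.
Context (R : realType) (k : scalars) (M : model R k) (D : discretization M).
Implicit Types (T U : {fset element D}) (v w : M).

Lemma lambda_opt_gt0 c (qctr Cstab alpha : R) : 0 < qctr < 1 -> 0 < Cstab ->
  0 < alpha -> 0 < lambda_opt c qctr Cstab alpha.
Proof.
move=> /andP[q0 q1] C0 a0; have ? : 0 < (1 - qctr) / (qctr * Cstab).
  by rewrite divr_gt0 ?mulr_gt0 ?subr_gt0.
by case: c => //=; rewrite mulr_gt0// sqrtr_gt0 divr_gt0.
Qed.

(** Contraction turns the distance of two consecutive iterates into a bound for
    the error of the second. For the energy this uses that the energy decreases
    by at least (q^-2 - 1) times the new energy error, that
    1 - q^2 >= (1 - q)^2, and [energy_lower_bound]. *)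
Lemma solver_error c (qctr Cstab alpha : R) T v : 0 < qctr < 1 -> 0 < Cstab ->
  0 < alpha -> strongly_monotone M alpha -> contractive D c qctr ->
  admissible T -> dspace T v ->
  Cstab * lambda_opt c qctr Cstab alpha * hnorm (discrete_sol D T - solver T v)
    <= distance c (solver T v) v.
Proof.
move=> /andP[q0 q1] C0 a0 mono ctr aT Tv.
have := ctr _ _ aT Tv; have Tw := solver_dspace aT Tv.
have q1' : 0 < 1 - qctr by rewrite subr_gt0.
set w := solver T v; set u := discrete_sol D T.
case: c {ctr} => /= ctr.
- have wu := energy_lower_bound mono (dspaceP aT) (discrete_solP aT) Tw.
  have {}wu : alpha / 2 * hnorm (u - w) ^+ 2 <= energy w - energy u.
    by rewrite hnormC.
  have := hnorm_ge0 (u - w); move: wu; set h := hnorm _ => wu h0.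
  set x := (1 - qctr) / qctr.
  have -> : Cstab * ((1 - qctr) / (qctr * Cstab) * Num.sqrt (alpha / 2)) * h
      = x * Num.sqrt (alpha / 2) * h.
    by rewrite /x; field; rewrite !gt_eqF.
  have x0 : 0 < x by rewrite divr_gt0.
  rewrite -ler_sqr ?nnegrE ?sqrtr_ge0 ?mulr_ge0 ?sqrtr_ge0 ?invr_ge0 ?(ltW q0)
    ?(ltW q1')//.
  rewrite sqr_sqrtr// (le_trans _ (ler_norm _))//.
  rewrite !exprMn sqr_sqrtr ?divr_ge0 ?(ltW a0)//.
  rewrite -mulrA -exprMn -/x; apply: (le_trans (ler_wpM2l (sqr_ge0 x) wu)).
  have e0 : 0 <= energy w - energy u.
    by apply: le_trans wu; rewrite mulr_ge0 ?sqr_ge0// divr_ge0// ltW.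
  rewrite /x expr_div_n mulrAC ler_pdivrMr ?exprn_gt0//.
  have := mulr_ge0 (ltW q0) (mulr_ge0 (ltW q1') e0).
  move: ctr; rewrite -/w -/u !expr2.
  set a := energy u; set b := energy v; set d := energy w.
  nra.
- rewrite (_ : Cstab * _ = (1 - qctr) / qctr); last first.
    by field; rewrite !gt_eqF.
  rewrite mulrAC ler_pdivrMr//.
  have := ler_wpM2l (ltW q0) (hnorm_triangle w u v).
  by move: ctr; rewrite -/w -/u; lra.
Qed.

End Solver.

Section Marking.
Context (R : realType) (k : scalars) (M : model R k) (D : discretization M).
Context (c : contraction_kind) (alpha qctr Cson Cmesh Cstab qred Crel : R).
Context (theta lambda Cmark s : R).
Context (alpha0 : 0 < alpha) (mono : strongly_monotone M alpha).
Context (qctr01 : 0 < qctr < 1) (ctr : contractive D c qctr).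
Context (son : son_estimate D Cson) (ovl : overlay_estimate D).
Context (clos : closure_estimate D Cmesh).
Context (Cstab0 : 0 < Cstab) (stab : stability D Cstab).
Context (qred01 : 0 < qred < 1) (red : reduction D qred).
Context (Crel0 : 0 < Crel) (drel : discrete_reliability D Crel).
Context (s0 : 0 < s) (Cmark0 : 0 <= Cmark).
Context (r : run D) (rP : adaptive_run c theta lambda Cmark r).

(** The closure estimate concerns infinite sequences of refinements, so the first
    l steps of the run are continued by steps without marked elements. *)
Lemma mesh_closure l : level_reached r l ->
  #|` mesh r l|%:R <= #|` mesh0 D|%:R + Cmesh * \sum_(j < l) #|` marked r j|%:R.
Proof.
move=> rl; pose mk j := if (j < l)%N then marked r j else fset0.
have [Ts [Ts0 TsS]] : exists Ts, Ts 0%N = mesh0 D /\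
    forall j, Ts j.+1 = refine D (Ts j) (mk j).
  by exists (fix Ts j := if j is i.+1 then refine D (Ts i) (mk i) else mesh0 D).
have TsE j : (j <= l)%N -> Ts j = mesh r j.
  elim: j => [_|j IH jl]; first by rewrite Ts0; case: rP.
  have [n [_ _ _ [_ _ -> _] _]] := level_step rP (level_reached_le jl rl).
  by rewrite TsS /mk jl IH// (ltnW jl).
have mkT j : mk j `<=` Ts j /\ Ts j.+1 = refine D (Ts j) (mk j).
  split => //; rewrite /mk; case: ifPn => jl; last exact: fsub0set.
  rewrite (TsE _ (ltnW jl)).
  have [n [_ _ _ [[mT _] _ _ _] _]] := level_step rP (level_reached_le jl rl).
  exact: mT.
have := clos Ts0 mkT l; rewrite (TsE _ (leqnn l)) lerBlDl.
rewrite (eq_bigr (fun j : 'I_l => #|` marked r j|%:R))//.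
by move=> j _; rewrite /mk ltn_ord.
Qed.

Local Notation lopt := (lambda_opt c qctr Cstab alpha).
Local Notation mu := (lambda / lopt).

Lemma final_iterate_error l n : level_reached r l.+1 -> last_step r l = Some n ->
  Cstab * hnorm (discrete_sol D (mesh r l) - iterate r l n)
    <= mu * iterate_estimator r l n.
Proof.
move=> rl1 ln; have [m [+ m0 rl _ +]] := level_step rP rl1.
rewrite ln => -[<-] {m m0}; have lopt0 := lambda_opt_gt0 c qctr01 Cstab0 alpha0.
have n0 : (0 < n)%N.
  by case: rP => _ _ _ /(_ l rl); rewrite ln => -[].
case: n n0 ln => // n _ ln; rewrite /stopping/=.
have [_ _ itS _ _] := rP.
have bn : before_last r l n by rewrite /before_last ln.
have dn : dspace (mesh r l) (iterate r l n) by apply: (iterate_dspace rP rl); left.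
have := solver_error qctr01 Cstab0 alpha0 mono ctr (mesh_admissible rP rl) dn.
rewrite -itS// => /le_trans h /h {}h.
by rewrite mulrAC ler_pdivlMr// mulrAC.
Qed.

Lemma final_iterate_dspace l n : level_reached r l -> last_step r l = Some n ->
  dspace (mesh r l) (iterate r l n).
Proof. by move=> rl ln; apply: (iterate_dspace rP rl); right. Qed.

Lemma estimator_final_le l n U : level_reached r l.+1 -> last_step r l = Some n ->
  U `<=` mesh r l ->
  estimator (mesh r l) U (discrete_sol D (mesh r l))
    <= estimator (mesh r l) U (iterate r l n) + mu * iterate_estimator r l n.
Proof.
move=> rl1 ln UT; have rl := level_reached_le (leqnSn l) rl1.
have aT := mesh_admissible rP rl.
rewrite (le_trans (estimator_stable stab aT UT (discrete_solP aT).1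
  (final_iterate_dspace rl ln)))// lerD2l.
exact: final_iterate_error.
Qed.

Lemma estimator_exact_ge l n : level_reached r l.+1 -> last_step r l = Some n ->
  (1 - mu) * iterate_estimator r l n
    <= estimator (mesh r l) (mesh r l) (discrete_sol D (mesh r l)).
Proof.
move=> rl1 ln; have rl := level_reached_le (leqnSn l) rl1.
have aT := mesh_admissible rP rl.
rewrite mulrBl mul1r lerBlDr (le_trans (estimator_stable stab aT (fsubset_refl _)
  (final_iterate_dspace rl ln) (discrete_solP aT).1))// lerD2l hnormC.
exact: final_iterate_error.
Qed.

Context (lambda_theta : 0 < lambda < lopt * theta) (theta01 : 0 < theta <= 1).
Context (theta_opt : 0 < (theta + mu) / (1 - mu)
  < (Num.sqrt (1 + Cstab ^+ 2 * Crel ^+ 2))^-1).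

Lemma mu_bounds : 0 < mu < 1.
Proof.
have lopt0 := lambda_opt_gt0 c qctr01 Cstab0 alpha0.
have [l0 lt] := andP lambda_theta; have [th0 th1] := andP theta01.
rewrite divr_gt0//= ltr_pdivrMr// mul1r (lt_le_trans lt)//.
by rewrite ler_piMr// ltW.
Qed.

(** theta' = (theta + mu) / (1 - mu) is the value for which the marking property of
    the exact discrete solution implies that of the final iterate: passing to the
    exact solution costs the factor 1 - mu, and passing back the summand mu. *)
Lemma marking_cost (B f q : R) l n :
  0 <= B -> (approx_norm D s <= B%:E)%E ->
  0 <= f <= 1 -> 0 < q <= 1 ->
  q * (1 + 2 * (Cstab * Crel)) <= f * (Cstab * Crel) ^+ 2 ->
  level_reached r l.+1 -> last_step r l = Some n -> 0 < iterate_estimator r l n ->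
  #|` marked r l|%:R <= Cmark *
   ((B / (q / (1 + Cstab * Crel) * ((1 - mu) * iterate_estimator r l n))) `^ s^-1
     + 1 + f * #|` mesh r l|%:R).
Proof.
move=> B0 AB f01 q01 qf rl1 ln eta0.
have [m [+ _ rl [_ Mmin _ _] _]] := level_step rP rl1.
rewrite ln => -[mn]; rewrite -mn in Mmin.
have aT := mesh_admissible rP rl; have [mu0 mu1] := andP mu_bounds.
have mu1' : 0 < 1 - mu by rewrite subr_gt0.
set u := discrete_sol D (mesh r l).
have ge := estimator_exact_ge rl1 ln.
have etau : 0 < estimator (mesh r l) (mesh r l) u.
  by apply: lt_le_trans ge; rewrite mulr_gt0.
have C0 : 0 < Cstab * Crel by rewrite mulr_gt0.
pose th := (theta + mu) / (1 - mu).
have [th0 th1] := andP theta_opt.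
have th2 : th ^+ 2 * (1 + (Cstab * Crel) ^+ 2) <= 1.
  rewrite [(Cstab * Crel) ^+ 2]exprMn; set S := 1 + Cstab ^+ 2 * _ in th1 *.
  have S0 : 0 < S by rewrite addr_gt0// mulr_gt0// exprn_gt0.
  rewrite -ler_pdivlMr// mul1r -[leRHS](sqr_sqrtr (ltW _)) ?invr_gt0//.
  by rewrite ler_sqr ?nnegrE ?sqrtr_ge0 ?(ltW th0)// sqrtrV ?ltW.
have [U [UT Uth cU]] := cheap_doerfler_set son ovl Cstab0 stab qred01 red Crel0 drel
  s0 B0 AB f01 q01 qf (ltW th0) th2 aT etau.
have dU : doerfler theta (mesh r l) U (iterate r l n).
  have thE : th * (1 - mu) = theta + mu by rewrite /th divfK ?gt_eqF.
  have := estimator_final_le rl1 ln UT.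
  rewrite -/u => fin; split => //; rewrite -/(iterate_estimator r l n).
  have := ler_wpM2l (ltW th0) ge; rewrite -/th mulrA thE -/u mulrDl => geth.
  by have := le_trans geth (le_trans Uth fin); rewrite lerD2r.
rewrite (le_trans (Mmin _ dU))// ler_wpM2l// (le_trans cU)// -!addrA lerD2r.
have [q0 _] := andP q01.
have : 0 < q / (1 + Cstab * Crel) by rewrite divr_gt0// addr_gt0.
set a := q / _ => a0.
have x0 : 0 < a * ((1 - mu) * iterate_estimator r l n).
  exact: mulr_gt0 a0 (mulr_gt0 mu1' eta0).
have y0 : 0 < a * estimator (mesh r l) (mesh r l) u by exact: mulr_gt0.
have si0 : 0 <= s^-1 by rewrite invr_ge0 ltW.
rewrite (ge0_ler_powR si0)// ?nnegrE ?mulr_ge0 ?invr_ge0 ?(ltW x0) ?(ltW y0)//.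
apply: ler_wpM2l => //; rewrite lef_pV2 ?posrE//.
by rewrite ler_pM2l.
Qed.

End Marking.

(** * Geometric sums *)

Section Sequences.
Context (R : realType).
Implicit Types (g : R).

Lemma geometric_sum_le g n : 0 <= g < 1 -> \sum_(i < n) g ^+ i <= (1 - g)^-1.
Proof.
move=> /andP[g0 g1]; have g1' : 0 < 1 - g by rewrite subr_gt0.
have := subrX1 g n; rewrite -(ler_pM2l g1') divff ?gt_eqF// => h.
have : 0 <= g ^+ n by rewrite exprn_ge0.
lra.
Qed.

(** The exponents are distinct, so the sum is part of a geometric series. *)
Lemma geometric_sum_inj_le (I : choiceType) (A : {fset I}) (phi : I -> nat) g :
  0 <= g < 1 -> {in A &, injective phi} ->
  \sum_(i <- A) g ^+ phi i <= (1 - g)^-1.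
Proof.
move=> g01 phi_inj; have [g0 _] := andP g01.
have [N phiN] : exists N, forall i, i \in A -> (phi i < N)%N.
  by exists (\max_(i <- A) phi i).+1 => i iA; rewrite ltnS leq_bigmax_seq.
apply: le_trans (geometric_sum_le N g01).
rewrite -(big_map phi xpredT (fun j => g ^+ j)) -(big_mkord xpredT (fun j => g ^+ j)).
rewrite /index_iota subn0.
have pe : perm_eq [seq phi i | i <- A] [seq j <- iota 0 N | j \in [seq phi i | i <- A]].
  apply: uniq_perm; first by rewrite map_inj_in_uniq.
    by rewrite filter_uniq// iota_uniq.
  move=> j; rewrite mem_filter; case: (boolP (j \in _)) => //= /mapP[i iA ->].
  by rewrite mem_iota add0n phiN.
rewrite (perm_big _ pe) big_filter big_mkcond ler_sum//= => j _.
by case: ifP => // _; rewrite exprn_ge0.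
Qed.

Lemma subn_rev n i : (i < n)%N -> (n - (n - i.+1).+1)%N = i.
Proof. lia. Qed.

(** A discrete Gronwall inequality, by strong induction on the index: as b grows
    geometrically up to the factor K1, its sums are bounded by its last value, and
    if f is small compared with 1 - g, the terms f * t i reproduce at most half of
    the bound that is being proved. *)
Lemma growth_bound (t b : nat -> R) (l : nat) (n0 CC K0 K1 f g : R) :
  0 <= g < 1 -> 0 <= n0 -> 0 <= CC -> 0 <= K0 -> 0 <= K1 -> 0 <= f ->
  CC * f * K1 / (1 - g) <= 2^-1 ->
  (forall j, (j <= l)%N -> 1 <= K1 * b j) ->
  (forall i j, (i <= j <= l)%N -> b i <= K1 * g ^+ (j - i) * b j) ->
  (forall j, (j <= l)%N -> 0 <= b j) ->
  (forall j, (j <= l)%N ->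
     t j <= n0 + CC * \sum_(i < j) (K0 * b i.+1 + 1 + f * t i)) ->
  t l <= 2 * (n0 * K1 + CC * ((K0 + K1) * K1 / (1 - g))) * b l.
Proof.
move=> g01 n00 CC0 K00 K10 f0 small b1 bg b0 tb.
have [g0 g1] := andP g01; have g1' : 0 < 1 - g by rewrite subr_gt0.
set X := n0 * K1 + _.
have X0 : 0 <= X.
  by rewrite addr_ge0 ?mulr_ge0 ?addr_ge0 ?invr_ge0 ?(ltW g1').
suff H j : (j <= l)%N -> t j <= 2 * X * b j by exact: H.
elim/ltn_ind: j => j IH jl.
have bj0 := b0 _ jl.
have geo : \sum_(i < j) K1 * b j * g ^+ (j - i.+1) <= K1 / (1 - g) * b j.
  rewrite -mulr_sumr [leRHS]mulrAC ler_wpM2l ?mulr_ge0//.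
  rewrite (reindex_inj rev_ord_inj)/= (le_trans _ (geometric_sum_le j g01))//.
  apply: ler_sum => i _; rewrite le_eqVlt; apply/orP; left; apply/eqP.
  by rewrite subn_rev.
have S1 : \sum_(i < j) b i.+1 <= K1 / (1 - g) * b j.
  apply: le_trans geo; apply: ler_sum => i _; rewrite mulrAC; apply: bg.
  by rewrite ltn_ord jl.
have S2 : \sum_(i < j) b i <= K1 / (1 - g) * b j.
  apply: le_trans geo; apply: ler_sum => i _; have ij := ltn_ord i.
  rewrite mulrAC (le_trans (bg i j _)) ?jl ?(ltnW ij)//.
  apply: ler_wpM2r => //; apply: ler_wpM2l => //.
  by apply: (ler_wiXn2l g0 (ltW g1)); exact: leq_sub2l.
have S3 : \sum_(i < j) (K0 * b i.+1 + 1 + f * t i) <=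
   (K0 + K1) * \sum_(i < j) b i.+1 + f * (2 * X) * \sum_(i < j) b i.
  rewrite !mulr_sumr -big_split/=; apply: ler_sum => i _; have ij := ltn_ord i.
  rewrite mulrDl -[f * _ * _]mulrA lerD//.
    by rewrite lerD2l b1// (leq_trans ij).
  by rewrite ler_wpM2l// IH// (leq_trans _ jl)// ltnW.
apply: (le_trans (tb _ jl)).
have A1 : n0 <= n0 * K1 * b j by rewrite -mulrA ler_peMr// b1.
have A2 : (K0 + K1) * \sum_(i < j) b i.+1 <= (K0 + K1) * (K1 / (1 - g) * b j).
  by rewrite ler_wpM2l// addr_ge0.
have A3 : f * (2 * X) * \sum_(i < j) b i <= f * (2 * X) * (K1 / (1 - g) * b j).
  by rewrite ler_wpM2l// !mulr_ge0.
have A4 : CC * \sum_(i < j) (K0 * b i.+1 + 1 + f * t i) <=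
    CC * ((K0 + K1) * (K1 / (1 - g) * b j) + f * (2 * X) * (K1 / (1 - g) * b j)).
  by rewrite ler_wpM2l// (le_trans S3)// lerD.
have A5 : (CC * f * K1 / (1 - g)) * (2 * X * b j) <= 2^-1 * (2 * X * b j).
  by rewrite ler_wpM2r// !mulr_ge0.
have -> : 2 * X * b j = n0 * K1 * b j + (CC * ((K0 + K1) * (K1 / (1 - g) * b j))
    + 2^-1 * (2 * X * b j)).
  by rewrite /X; field; rewrite gt_eqF.
have E : CC * (f * (2 * X) * (K1 / (1 - g) * b j)) =
    (CC * f * K1 / (1 - g)) * (2 * X * b j).
  by field; rewrite gt_eqF.
by rewrite lerD// (le_trans A4)// mulrDr lerD2l E.
Qed.

End Sequences.

(** * The upper bound *)

Section UpperConstant.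
Context (R : realType).
Context (Cstab Crel Cmesh delta Cmark Crel' Clin qlin : R) (n : nat) (s : R).

Definition decay_rate : R := qlin `^ s^-1.
Definition decay_factor : R := Clin `^ s^-1.

(** The largest fraction of heavy elements for which [growth_bound] absorbs the
    feedback of the mesh size on the marking. *)
Definition feedback : R :=
  Num.min 1 ((1 - decay_rate) / (2 * (Cmesh * Cmark) * decay_factor)).

(** The reduction factor demanded from the overlay, small enough for
    [cheap_doerfler_set] with the fraction [feedback] of heavy elements. *)
Definition overlay_gain : R :=
  Num.min 1 (feedback * (Cstab * Crel) ^+ 2 / (1 + 2 * (Cstab * Crel))).

Definition marking_factor : R :=
  (Crel' * (1 + Cstab * Crel) / (overlay_gain * delta)) `^ s^-1.

Definition mesh_factor : R :=
  2 * (n%:R * decay_factor + Cmesh * Cmark *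
    ((marking_factor + decay_factor) * decay_factor / (1 - decay_rate))).

Definition cost_factor : R :=
  mesh_factor * decay_factor * decay_factor / (1 - decay_rate).

Definition upper_constant : R := Num.max 1 (cost_factor `^ s).

Lemma upper_constant_gt0 : 0 < upper_constant.
Proof. by rewrite lt_max ltr01. Qed.

Context (s0 : 0 < s) (Clin1 : 1 <= Clin) (qlin01 : 0 < qlin < 1).

Lemma decay_rate01 : 0 < decay_rate < 1.
Proof.
have [q0 q1] := andP qlin01; rewrite powR_gt0//= /decay_rate.
have -> : 1 = 1 `^ s^-1 :> R by rewrite powR1.
by rewrite gt0_ltr_powR ?invr_gt0// nnegrE ltW.
Qed.

Lemma decay_factor_gt0 : 0 < decay_factor.
Proof. by rewrite powR_gt0// (lt_le_trans ltr01). Qed.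

Context (Cstab0 : 0 < Cstab) (Crel0 : 0 < Crel).
Context (Cmesh0 : 0 < Cmesh) (Cmark0 : 0 < Cmark).

Let C0 : 0 < Cstab * Crel.
Proof. exact: mulr_gt0. Qed.

Lemma feedback_bounds : 0 < feedback <= 1.
Proof.
have [g0 g1] := andP decay_rate01.
rewrite lt_min ltr01 ge_min lexx andbT/= divr_gt0 ?subr_gt0//.
by rewrite !mulr_gt0// decay_factor_gt0.
Qed.

Lemma feedback_small :
  Cmesh * Cmark * feedback * decay_factor / (1 - decay_rate) <= 2^-1.
Proof.
have [g0 g1] := andP decay_rate01; have K0 := decay_factor_gt0.
rewrite ler_pdivrMr ?subr_gt0// mulrAC -ler_pdivlMl ?mulr_gt0//.
rewrite ge_min; apply/orP; right; rewrite le_eqVlt; apply/orP; left; apply/eqP.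
by field; rewrite !gt_eqF.
Qed.

Lemma overlay_gain_bounds : 0 < overlay_gain <= 1.
Proof.
have [f0 _] := andP feedback_bounds.
rewrite lt_min ltr01 ge_min lexx andbT/= divr_gt0//.
  by rewrite mulr_gt0// exprn_gt0.
by rewrite addr_gt0// mulr_gt0.
Qed.

Lemma overlay_gain_small : overlay_gain * (1 + 2 * (Cstab * Crel)) <=
  feedback * (Cstab * Crel) ^+ 2.
Proof.
by rewrite -ler_pdivlMr ?addr_gt0 ?mulr_gt0// ge_min lexx orbT.
Qed.

Lemma mesh_factor_ge0 : 0 <= mesh_factor.
Proof.
have [g0 g1] := andP decay_rate01; have K0 := ltW decay_factor_gt0.
have m0 : 0 <= marking_factor by exact: powR_ge0.
have g1' : 0 <= (1 - decay_rate)^-1 by rewrite invr_ge0 subr_ge0 ltW.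
by rewrite mulr_ge0// addr_ge0 ?mulr_ge0// ?addr_ge0// ltW.
Qed.

End UpperConstant.

Section PowerFacts.
Context (R : realType).

Lemma powR_exprn (x sigma : R) m : 0 <= x -> (x ^+ m) `^ sigma = (x `^ sigma) ^+ m.
Proof.
move=> x0; elim: m => [|m IH]; first by rewrite !expr0 powR1.
by rewrite !exprS powRM ?exprn_ge0// IH.
Qed.

Lemma ler_powR_root (s x y : R) : 0 < s -> 0 <= x -> x <= y -> x `^ s^-1 <= y `^ s^-1.
Proof.
move=> s0 x0 xy; apply: ge0_ler_powR (xy); rewrite ?nnegrE//; last exact: le_trans xy.
by rewrite invr_ge0 ltW.
Qed.

End PowerFacts.

Section UpperBound.
Context (R : realType) (k : scalars) (M : model R k) (D : discretization M).
Context (c : contraction_kind) (alpha qctr Cson Cmesh Cstab qred Crel : R).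
Context (theta lambda Cmark s : R).
Context (alpha0 : 0 < alpha) (mono : strongly_monotone M alpha).
Context (qctr01 : 0 < qctr < 1) (ctr : contractive D c qctr).
Context (son : son_estimate D Cson) (ovl : overlay_estimate D).
Context (Cmesh0 : 0 < Cmesh) (clos : closure_estimate D Cmesh).
Context (Cstab0 : 0 < Cstab) (stab : stability D Cstab).
Context (qred01 : 0 < qred < 1) (red : reduction D qred).
Context (Crel0 : 0 < Crel) (drel : discrete_reliability D Crel).
Context (s0 : 0 < s) (Cmark1 : 1 <= Cmark).
Context (r : run D) (rP : adaptive_run c theta lambda Cmark r).
Local Notation lopt := (lambda_opt c qctr Cstab alpha).
Local Notation mu := (lambda / lopt).
Context (lambda_theta : 0 < lambda < lopt * theta) (theta01 : 0 < theta <= 1).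
Context (theta_opt : 0 < (theta + mu) / (1 - mu)
  < (Num.sqrt (1 + Cstab ^+ 2 * Crel ^+ 2))^-1).
Context (Clin qlin Crel' : R).
Context (Clin1 : 1 <= Clin) (qlin01 : 0 < qlin < 1).
Context (lin : linear_convergence Clin qlin r).
Context (Crel'0 : 0 < Crel') (control : error_control c Crel' r).
Implicit Types p q : nat * nat.

Lemma quasi_error_ge0 p : 0 <= quasi_error r p.
Proof. by rewrite addr_ge0 ?hnorm_ge0 ?estimator_ge0. Qed.

Lemma quasi_error_decay p q : indices r p -> indices r q -> index_le p q ->
  quasi_error r q <= Clin * qlin ^+ (step_count r q - step_count r p) * quasi_error r p.
Proof.
move=> ip iq; rewrite index_le_eqVlt => /predU1P[->|pq]; last exact: lin.
by rewrite subnn mulr1 ler_peMl// quasi_error_ge0.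
Qed.

Lemma quasi_error_gt0_before p q : indices r p -> indices r q -> index_le p q ->
  0 < quasi_error r q -> 0 < quasi_error r p.
Proof.
move=> ip iq pq q0; rewrite lt_def quasi_error_ge0 andbT; apply/negP => /eqP p0.
by have := quasi_error_decay ip iq pq; rewrite p0 mulr0 leNgt q0.
Qed.

Context (B : R) (approxB : (approx_norm D s <= B%:E)%E).
Context (startB : quasi_error r (0%N, 0%N) <= B).

Lemma bound_ge0 : 0 <= B.
Proof. exact: le_trans (quasi_error_ge0 _) startB. Qed.

Local Notation g := (decay_rate qlin s).
Local Notation K1 := (decay_factor Clin s).

(** As B bounds the approximation norm, this many additional elements suffice, up
    to constants, to reach the accuracy of the step p. *)
Definition optimal_cost p : R := (B / quasi_error r p) `^ s^-1.

Lemma optimal_cost_ge0 p : 0 <= optimal_cost p.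
Proof. exact: powR_ge0. Qed.

(** Linear convergence raised to the power -1/s: the optimal cost grows at least
    geometrically along the run. *)
Lemma optimal_cost_decay p q : indices r p -> indices r q -> index_le p q ->
  0 < quasi_error r q ->
  optimal_cost p <= K1 * g ^+ (step_count r q - step_count r p) * optimal_cost q.
Proof.
move=> ip iq pq q0; have p0 := quasi_error_gt0_before ip iq pq q0.
have [ql0 _] := andP qlin01.
rewrite -powR_exprn ?(ltW ql0)// -!powRM ?divr_ge0 ?mulr_ge0 ?exprn_ge0 ?bound_ge0//
  ?quasi_error_ge0 ?(ltW ql0) ?(le_trans ler01 Clin1)//.
apply: ler_powR_root => //; first by rewrite divr_ge0 ?bound_ge0// quasi_error_ge0.
rewrite mulrCA ler_wpM2l ?bound_ge0// -[leLHS]mul1r ler_pdivrMr// mulrAC.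
by rewrite ler_pdivlMr// mul1r quasi_error_decay.
Qed.

Lemma optimal_cost_ge p : indices r p -> 0 < quasi_error r p ->
  1 <= K1 * optimal_cost p.
Proof.
move=> ip p0; have i0 : indices r (0%N, 0%N) by exact: (level_start rP).
have le0 : index_le (0%N, 0%N) p by rewrite index_leE; case: (p) => -[].
have c0 : Clin * B / quasi_error r p >= 1.
  have [ql0 ql1] := andP qlin01.
  rewrite ler_pdivlMr// mul1r.
  apply: le_trans (quasi_error_decay i0 ip le0) _; apply: ler_pM => //.
  - by rewrite mulr_ge0 ?exprn_ge0 ?(ltW ql0) ?(le_trans ler01).
  - exact: quasi_error_ge0.
  - by rewrite ler_piMr ?(le_trans ler01)// exprn_ile1// ltW.
rewrite -powRM ?divr_ge0 ?bound_ge0 ?quasi_error_ge0 ?(le_trans ler01)//.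
by have := ler_powR_root s0 ler01 c0; rewrite powR1 mulrA.
Qed.

Local Notation gain := (overlay_gain Cstab Crel Cmesh Cmark Clin qlin s).
Local Notation feed := (feedback Cmesh Cmark Clin qlin s).
Local Notation mfac :=
  (marking_factor Cstab Crel Cmesh (1 - mu) Cmark Crel' Clin qlin s).
Local Notation meshfac := (mesh_factor Cstab Crel Cmesh (1 - mu) Cmark Crel' Clin qlin
  #|` mesh0 D| s).

Let Cmark0 : 0 < Cmark := lt_le_trans ltr01 Cmark1.

(** The a posteriori bound trades the estimator at the end of level l for the
    quasi-error at the start of the next one. *)
Lemma marked_le l : level_reached r l.+1 -> 0 < quasi_error r (l.+1, 0%N) ->
  #|` marked r l|%:R <= Cmark *
    (mfac * optimal_cost (l.+1, 0%N) + 1 + feed * #|` mesh r l|%:R).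
Proof.
move=> rl1 D0; have [n [ln _ rl [_ _ _ itE] _]] := level_step rP rl1.
have eta_ge : quasi_error r (l.+1, 0%N) <= Crel' * iterate_estimator r l n.
  by have [_ _ /(_ l rl1)] := control; rewrite itE.
have eta0 : 0 < iterate_estimator r l n.
  by rewrite -(pmulr_rgt0 _ Crel'0); exact: lt_le_trans eta_ge.
have fb := feedback_bounds s0 Clin1 qlin01 Cmesh0 Cmark0.
have [f0 f1] := andP fb.
have gb := overlay_gain_bounds s0 Clin1 qlin01 Cstab0 Crel0 Cmesh0 Cmark0.
have [q0 q1] := andP gb.
have gs := overlay_gain_small Cmesh Cmark Clin qlin s Cstab0 Crel0.
have f01 : 0 <= feed <= 1 by rewrite ltW.
apply: le_trans (marking_cost alpha0 mono qctr01 ctr son ovl Cstab0 stab qred01 red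
  Crel0 drel s0 (ltW Cmark0) rP lambda_theta theta01 theta_opt bound_ge0 approxB f01 gb
  gs rl1 ln eta0) _.
rewrite ler_wpM2l ?(ltW Cmark0)// !lerD2r.
have [_ mu1] := andP (mu_bounds alpha0 qctr01 Cstab0 lambda_theta theta01).
have mu1' : 0 < 1 - mu by rewrite subr_gt0.
have C1 : 0 < 1 + Cstab * Crel by rewrite addr_gt0// mulr_gt0.
rewrite /marking_factor -powRM; last 2 first.
- by rewrite divr_ge0 ?mulr_ge0 ?(ltW C1) ?(ltW mu1') ?(ltW q0) ?(ltW Crel'0).
- by rewrite divr_ge0 ?bound_ge0 ?(ltW D0).
apply: ler_powR_root => //.
  by rewrite divr_ge0 ?bound_ge0 ?mulr_ge0 ?invr_ge0 ?(ltW C1) ?(ltW mu1') ?(ltW q0)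
    ?(ltW eta0).
move: eta_ge eta0 mu1' C1 q0 D0; set e := iterate_estimator r l n; set d := 1 - mu.
set C := 1 + Cstab * Crel; set G := gain; set E := quasi_error _ _.
move=> eta_ge eta0 d0 C0 G0 E0.
have -> : B / (G / C * (d * e)) = (C / (G * d)) * (B / e).
  by field; rewrite !gt_eqF.
have -> : Crel' * C / (G * d) * (B / E) = (C / (G * d)) * (B * (Crel' / E)).
  by field; rewrite !gt_eqF.
rewrite ler_wpM2l ?divr_ge0 ?mulr_ge0 ?(ltW C0) ?(ltW d0) ?(ltW G0)//.
rewrite ler_wpM2l ?bound_ge0// ler_pdivlMr// mulrC ler_pdivrMr//.
Qed.

Lemma mesh_le l : level_reached r l -> 0 < quasi_error r (l, 0%N) ->
  #|` mesh r l|%:R <= meshfac * optimal_cost (l, 0%N).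
Proof.
move=> rl D0; have [g0 g1] := andP (decay_rate01 s0 qlin01).
have g01 : 0 <= g < 1 by rewrite ltW.
have K10 := decay_factor_gt0 s Clin1.
have [f0 f1] := andP (feedback_bounds s0 Clin1 qlin01 Cmesh0 Cmark0).
have ij_le i j : (i <= j)%N -> index_le (i, 0%N) (j, 0%N).
  by rewrite index_leE leqnn andbT orbC -leq_eqVlt.
have st j : (j <= l)%N -> indices r (j, 0%N).
  by move=> jl; apply: (level_start rP); exact: level_reached_le rl.
have Dj j : (j <= l)%N -> 0 < quasi_error r (j, 0%N).
  move=> jl; apply: (quasi_error_gt0_before (st _ jl) (st _ (leqnn l))) => //.
  exact: ij_le.
apply: (growth_bound (t := fun j => #|` mesh r j|%:R)
  (b := fun j => optimal_cost (j, 0%N)) g01 (n0 := #|` mesh0 D|%:R)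
  (CC := Cmesh * Cmark) (K0 := mfac) (f := feed)) => //.
- by rewrite mulr_ge0// ltW.
- exact: powR_ge0.
- exact: ltW.
- exact: ltW.
- exact: feedback_small.
- by move=> j jl; apply: optimal_cost_ge; [exact: st|exact: Dj].
- move=> i j /andP[ij jl]; have il := leq_trans ij jl.
  apply: le_trans (optimal_cost_decay (st _ il) (st _ jl) (ij_le _ _ ij) (Dj _ jl)) _.
  apply: ler_wpM2r; first exact: optimal_cost_ge0.
  apply: ler_wpM2l; first exact: ltW.
  apply: (ler_wiXn2l (ltW g0) (ltW g1)).
  have h := step_count_levels rP ij (level_reached_le jl rl).
  by rewrite leq_subRL// (leq_trans _ h)// leq_addr.
- by move=> j _; exact: optimal_cost_ge0.
- move=> j jl; apply: le_trans (mesh_closure clos rP (level_reached_le jl rl)) _.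
  rewrite lerD2l -mulrA; apply: ler_wpM2l; first exact: ltW.
  rewrite mulr_sumr; apply: ler_sum => i _.
  have il : (i < l)%N by exact: leq_trans (ltn_ord i) jl.
  by apply: marked_le; [exact: level_reached_le rl|exact: Dj].
Qed.

Local Notation costfac := (cost_factor Cstab Crel Cmesh (1 - mu) Cmark Crel' Clin qlin
  #|` mesh0 D| s).

(** The mesh of each earlier step q is bounded through the optimal cost of q, which
    decays geometrically in the number of steps between q and p. *)
Lemma cumulative_cost_le p : indices r p -> 0 < quasi_error r p ->
  cumulative_cost r p <= costfac * optimal_cost p.
Proof.
move=> ip D0; have [g0 g1] := andP (decay_rate01 s0 qlin01).
have g01 : 0 <= g < 1 by rewrite ltW.
have K10 := decay_factor_gt0 s Clin1.
have mf0 : 0 <= meshfac by exact: mesh_factor_ge0.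
have fin := indices_le_finite ip.
rewrite /cumulative_cost fsbig_finite//=.
set A := fset_set _.
have AP q : q \in A -> indices r q /\ index_le q p.
  by rewrite in_fset_set// inE.
apply: (@le_trans _ _ (\sum_(q <- A) meshfac * K1 * K1 * optimal_cost p *
    g ^+ (step_count r p - step_count r q))).
  rewrite big_seq [leRHS]big_seq; apply: ler_sum => q /AP[iq qp].
  have q0 := quasi_error_gt0_before iq ip qp D0.
  have rq : level_reached r q.1 by case: iq.
  have is0 := level_start rP rq.
  have le0 : index_le (q.1, 0%N) q by rewrite index_leE ltnn eqxx.
  have s00 := quasi_error_gt0_before is0 iq le0 q0.
  apply: le_trans (mesh_le rq s00) _.
  set m := (_ - _)%N.
  rewrite [leRHS](_ : _ = meshfac * (K1 * (K1 * g ^+ m * optimal_cost p))); last first.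
    by move: meshfac => F; ring.
  apply: ler_wpM2l => //; apply: le_trans (optimal_cost_decay is0 iq le0 q0) _.
  rewrite -mulrA; apply: ler_wpM2l; first exact: ltW.
  apply: le_trans (optimal_cost_decay iq ip qp D0).
  by rewrite ler_piMl ?optimal_cost_ge0// exprn_ile1 ?ltW.
rewrite -mulr_sumr [leRHS](_ : _ = meshfac * K1 * K1 * optimal_cost p * (1 - g)^-1);
  last by rewrite /cost_factor mulrAC.
apply: ler_wpM2l; first exact:
  mulr_ge0 (mulr_ge0 (mulr_ge0 mf0 (ltW K10)) (ltW K10)) (optimal_cost_ge0 p).
apply: geometric_sum_inj_le => // q q' /AP[iq qp] /AP[iq' qp'] e.
have lep x : indices r x -> index_le x p -> (step_count r x <= step_count r p)%N.
  move=> ix; rewrite index_le_eqVlt => /predU1P[->//|xp].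
  by rewrite ltnW// step_count_lt.
have e1 := lep _ iq qp; have e2 := lep _ iq' qp'.
apply: (step_count_inj iq iq').
by rewrite -(subKn e1) e subKn.
Qed.

Lemma cost_error_le p : indices r p ->
  cumulative_cost r p `^ s * quasi_error r p <=
  upper_constant Cstab Crel Cmesh (1 - mu) Cmark Crel' Clin qlin #|` mesh0 D| s * B.
Proof.
move=> ip; have [p0|p0] := eqVneq (quasi_error r p) 0.
  by rewrite p0 mulr0 mulr_ge0 ?bound_ge0// ltW// upper_constant_gt0.
have {}p0 : 0 < quasi_error r p by rewrite lt_def p0 quasi_error_ge0.
have [g0 g1] := andP (decay_rate01 s0 qlin01).
have K10 := decay_factor_gt0 s Clin1.
have cost0 : 0 <= cumulative_cost r p.
  rewrite /cumulative_cost fsbig_finite; last exact: indices_le_finite.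
  exact: sumr_ge0.
have cf0 : 0 <= costfac.
  have mf0 : 0 <= meshfac by exact: mesh_factor_ge0.
  apply: divr_ge0; last by rewrite subr_ge0 ltW.
  exact: mulr_ge0 (mulr_ge0 mf0 (ltW K10)) (ltW K10).
have le1 : cumulative_cost r p `^ s <= (costfac * optimal_cost p) `^ s.
  apply: (ge0_ler_powR (ltW s0)) (cumulative_cost_le ip p0); rewrite nnegrE//.
  exact: mulr_ge0 cf0 (optimal_cost_ge0 p).
apply: le_trans (ler_wpM2r (quasi_error_ge0 p) le1) _.
have BD : 0 <= B / quasi_error r p by rewrite divr_ge0 ?bound_ge0 ?quasi_error_ge0.
rewrite powRM ?optimal_cost_ge0// powR_rootK// -mulrA divfK ?gt_eqF//.
by apply: ler_wpM2r; [exact: bound_ge0|rewrite le_max lexx orbT].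
Qed.

End UpperBound.

(** * The lower bound and the main result *)

Section LowerBound.
Context (R : realType) (k : scalars) (M : model R k) (D : discretization M).
Context (c : contraction_kind) (alpha L Cson Cstab : R).
Context (theta lambda Cmark s : R).
Context (alphaL : 0 < alpha <= L) (mono : strongly_monotone M alpha).
Context (lip : lipschitz_operator M L).
Context (Cson1 : 1 <= Cson) (son : son_estimate D Cson).
Context (Cstab0 : 0 < Cstab) (stab : stability D Cstab).
Context (s0 : 0 < s) (theta0 : 0 < theta).
Context (r : run D) (rP : adaptive_run c theta lambda Cmark r).
Context (Clin qlin Crel' : R).
Context (Clin1 : 1 <= Clin) (qlin01 : 0 < qlin < 1).
Context (lin : linear_convergence Clin qlin r).
Context (control : error_control c Crel' r).

Definition exact_error (T : {fset element D}) : R :=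
  hnorm (exact_sol D - discrete_sol D T) + estimator T T (discrete_sol D T).

Definition cea_constant (kappa : R) : R := Num.max 1 (kappa + Cstab * (1 + kappa)).

Lemma exact_error_le T v : admissible T -> dspace T v ->
  exact_error T <=
    cea_constant (L / alpha) * (hnorm (exact_sol D - v) + estimator T T v).
Proof.
move=> aT Tv.
have ce := cea alphaL mono lip (dspaceP aT) (exact_solP D) (discrete_solP aT) Tv.
have := estimator_stable stab aT (fsubset_refl T) (discrete_solP aT).1 Tv.
have := hnorm_triangle (exact_sol D) (discrete_sol D T) v.
rewrite (hnormC (discrete_sol D T) (exact_sol D)) /exact_error.
have := hnorm_ge0 (exact_sol D - v); have := estimator_ge0 T T v.
move: ce; set x := hnorm (_ - discrete_sol D T); set y := hnorm (_ - v).
set z := hnorm (_ - v); set e := estimator T T v; set K := L / alpha.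
move=> ce e0 y0 tri st.
have st' : Cstab * z <= Cstab * ((1 + K) * y) by rewrite ler_wpM2l ?(ltW Cstab0)//; lra.
have : (K + Cstab * (1 + K)) * y <= cea_constant K * y.
  by rewrite ler_wpM2r// le_max lexx orbT.
have : 1 * e <= cea_constant K * e by rewrite ler_wpM2r// le_max lexx.
lra.
Qed.

Lemma exact_error_iterate l j : level_reached r l ->
  (before_last r l j \/ last_step r l = Some j) ->
  exact_error (mesh r l) <= cea_constant (L / alpha) * quasi_error r (l, j).
Proof.
move=> rl lj; apply: exact_error_le; first exact: (mesh_admissible rP).
exact: (iterate_dspace rP).
Qed.

Lemma le_geometric_le0 (x C q : R) : 0 < q < 1 -> (forall n, x <= C * q ^+ n) -> x <= 0.
Proof.
move=> /andP[q0 q1] h.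
have : (fun n => C * q ^+ n) @ \oo --> (0 : R).
  by apply: cvg_geometric; rewrite ger0_norm// ltW.
by move/cvgr_to_ge; apply; near=> n; exact: h.
Unshelve. all: by end_near.
Qed.

(** If the solver never stops on level l, linear convergence drives the
    quasi-errors of its iterates to zero, and all of them dominate the error of
    the same exact discrete solution. *)
Lemma exact_error_unstopped l : level_reached r l -> last_step r l = None ->
  exact_error (mesh r l) <= 0.
Proof.
move=> rl ln; have bl j : before_last r l j by rewrite /before_last ln.
have ij j : indices r (l, j) by [].
set K := cea_constant (L / alpha).
have K0 : 0 <= K by rewrite le_max ler01.
have [q0 q1] := andP qlin01.
apply: (@le_geometric_le0 _ (K * (Clin * quasi_error r (l, 0%N))) qlin) => // n.
apply: le_trans (exact_error_iterate rl (or_introl (bl n))) _.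
rewrite -/K -!mulrA; apply: ler_wpM2l => //.
have le0 : index_le (l, 0%N) (l, n) by rewrite index_leE ltnn eqxx.
apply: le_trans (quasi_error_decay Clin1 lin (ij _) (ij _) le0) _.
rewrite -mulrA; apply: ler_wpM2l; first exact: le_trans Clin1.
rewrite mulrC; apply: ler_wpM2l; first exact: quasi_error_ge0.
apply: (ler_wiXn2l (ltW q0) (ltW q1)).
have h := step_count_inner (ij n).
by rewrite leq_subRL// (leq_trans _ h)// leq_addr.
Qed.

(** The empty set has the marking property only if the estimator vanishes, and
    then a posteriori error control makes the quasi-error vanish as well. *)
Lemma exact_error_unmarked l : level_reached r l.+1 -> marked r l = fset0 ->
  exact_error (mesh r l) <= 0.
Proof.
move=> rl1 m0; have [n [ln _ rl [[_ +] _ _ _] _]] := level_step rP rl1.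
rewrite m0 estimator0 pmulr_rle0// -/(iterate_estimator r l n) => e0.
have {}e0 : iterate_estimator r l n = 0.
  by apply/le_anti; rewrite e0 estimator_ge0.
apply: le_trans (exact_error_iterate rl (or_intror ln)) _.
have [_ /(_ l n rl ln) + _] := control; rewrite e0 mulr0 => h.
by rewrite mulr_ge0_le0// le_max ler01.
Qed.

Lemma card_mesh0_le l : level_reached r l -> (#|` mesh0 D| <= #|` mesh r l|)%N.
Proof.
move=> rl.
exact: card_refines_le son (admissible_mesh0 D) (mesh_admissible rP rl).
Qed.

(** Either the run passes the budget of N additional elements between two
    consecutive levels, or all its meshes stay within the budget. In the latter
    case marking at least one element on every level is impossible, as every such
    step adds an element. *)
Lemma mesh_exhausts N :
  (exists l, [/\ level_reached r l.+1, (#|` mesh r l| <= N + #|` mesh0 D|)%N &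
     (N + #|` mesh0 D| < #|` mesh r l.+1|)%N]) \/
  (exists T, [/\ admissible T, (#|` T| <= N + #|` mesh0 D|)%N & exact_error T <= 0]).
Proof.
pose P l := `[< level_reached r l /\ (N + #|` mesh0 D| < #|` mesh r l|)%N >].
have [exP|nP] := pselect (exists l, P l).
  left; case: (ex_minnP exP) => -[|l] /asboolP[rl ltl] minl.
    by move: ltl; have [-> _ _ _ _] := rP; rewrite ltnNge leq_addl.
  exists l; split => //; rewrite leqNgt; apply/negP => lt.
  have rl' := level_reached_le (leqnSn l) rl.
  by have := minl l (asboolT (conj rl' lt)); rewrite ltnn.
right; have small l : level_reached r l -> (#|` mesh r l| <= N + #|` mesh0 D|)%N.
  by move=> rl; rewrite leqNgt; apply/negP => lt; apply: nP; exists l; apply/asboolP.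
have [[l [rl ln]]|unst] :=
    pselect (exists l, level_reached r l /\ last_step r l = None).
  exists (mesh r l); split; [exact: (mesh_admissible rP)|exact: small|].
  exact: exact_error_unstopped.
have rall l : level_reached r l.
  elim: l => [//|l rl]; apply: level_reachedS => // ln.
  by apply: unst; exists l.
have [[l m0]|unm] := pselect (exists l, marked r l = fset0).
  exists (mesh r l); split; [exact: (mesh_admissible rP)|exact: small|].
  exact: exact_error_unmarked.
have grow l : (l + #|` mesh0 D| <= #|` mesh r l|)%N.
  elim: l => [|l IH]; first exact: card_mesh0_le.
  have [n [_ _ rl [[mT _] _ mE _] _]] := level_step rP (rall l.+1).
  have [+ _] := son (mesh_admissible rP rl) mT.
  have := fsubset_leq_card (refineP (mesh_admissible rP rl) mT).
  have : (0 < #|` marked r l|)%N.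
    by rewrite cardfs_gt0; apply/eqP => m0; apply: unm; exists l.
  rewrite -mE; lia.
by have := leq_trans (grow N.+1) (small _ (rall N.+1)); rewrite addSn ltnn.
Qed.

Definition lower_constant (kappa : R) (n : nat) : R :=
  cea_constant kappa * (Num.max 1 (Cson * n%:R)) `^ s.

Lemma lower_constant_gt0 kappa n : 0 < lower_constant kappa n.
Proof. by rewrite mulr_gt0 ?powR_gt0// lt_max ltr01. Qed.

Local Notation supmesh := (ereal_sup
    [set (((#|` mesh r p.1|)%:R - (#|` mesh0 D|)%:R + 1) `^ s
          * quasi_error r p)%:E | p in indices r]).

Lemma supmesh_ge l : level_reached r l ->
  ((((#|` mesh r l|)%:R - (#|` mesh0 D|)%:R + 1) `^ s * quasi_error r (l, 0%N))%:E
    <= supmesh)%E.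
Proof.
move=> rl; apply: ereal_sup_ubound; exists (l, 0%N) => //.
exact: (level_start rP).
Qed.

Lemma approx_norm_le :
  (approx_norm D s <= (lower_constant (L / alpha) #|` mesh0 D|)%:E * supmesh)%E.
Proof.
set K := lower_constant _ _; have K0 : 0 < K by exact: lower_constant_gt0.
apply: ge_ereal_sup => _ [N _ <-].
have inf_le T : admissible T -> (#|` T| <= N + #|` mesh0 D|)%N ->
    ((N.+1%:R `^ s)%:E * ereal_inf [set (hnorm (exact_sol D - discrete_sol D T)
                 + estimator T T (discrete_sol D T))%:E
              | T in meshes_upto N] <= (N.+1%:R `^ s * exact_error T)%:E)%E.
  move=> aT TN; rewrite EFinM; apply: lee_wpmul2l; first by rewrite lee_fin powR_ge0.
  by apply: ereal_inf_lbound; exists T => //; split => //; rewrite leq_subLR addnC.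
have [[l [rl1 lN Nl]]|[T [aT TN T0]]] := mesh_exhausts N; last first.
  apply: le_trans (inf_le T aT TN) _.
  apply: (@le_trans _ _ 0%E).
    by rewrite lee_fin mulr_ge0_le0// powR_ge0.
  apply: mule_ge0; first by rewrite lee_fin ltW.
  apply: le_trans (supmesh_ge (l := 0) _) => //.
  by rewrite lee_fin mulr_ge0 ?powR_ge0 ?quasi_error_ge0.
have [n [_ _ rl [[mT _] _ mE _] _]] := level_step rP rl1.
have aT := mesh_admissible rP rl.
apply: le_trans (inf_le _ aT lN) _.
apply: (le_trans _ (lee_wpmul2l _ (supmesh_ge rl))); last by rewrite lee_fin ltW.
rewrite -EFinM lee_fin.
have [i0 bl0] := level_start rP rl.
have ee := exact_error_iterate rl (or_introl bl0).
have n0 : (0 < #|` mesh0 D|)%N by rewrite cardfs_gt0 mesh0_neq0.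
have cl := card_mesh0_le rl.
have cson := card_refine_le Cson1 son aT mT.
set x := _ - _ + 1; have x1 : 1 <= x by rewrite lerDr subr_ge0 ler_nat.
have x0 : 0 <= x by exact: le_trans x1.
set m := Num.max 1 (Cson * #|` mesh0 D|%:R).
have m0 : 0 <= m by rewrite le_max ler01.
have N1 : N.+1%:R <= m * x.
  apply: (@le_trans _ _ #|` mesh r l.+1|%:R).
    by rewrite ler_nat; exact: leq_ltn_trans (leq_addr _ _) Nl.
  rewrite mE; apply: (le_trans cson).
  apply: (@le_trans _ _ (Cson * #|` mesh0 D|%:R * x)).
    rewrite -mulrA; apply: ler_wpM2l; first exact: le_trans Cson1.
    have n1 : 1 <= #|` mesh0 D|%:R :> R by rewrite ler1n.
    have ml : 0 <= #|` mesh r l|%:R - #|` mesh0 D|%:R :> R by rewrite subr_ge0 ler_nat.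
    by have := ler_wpM2r ml n1; rewrite /x; lra.
  by apply: ler_wpM2r => //; rewrite le_max lexx orbT.
have pw : N.+1%:R `^ s <= m `^ s * x `^ s.
  by rewrite -powRM// (ge0_ler_powR (ltW s0))// ?nnegrE ?mulr_ge0.
have e0 : 0 <= exact_error (mesh r l) by rewrite addr_ge0 ?hnorm_ge0 ?estimator_ge0.
have q0 := quasi_error_ge0 r (l, 0%N).
apply: le_trans (ler_pM (powR_ge0 _ _) e0 pw ee) _.
by rewrite /K /lower_constant -/m le_eqVlt; apply/orP; left; apply/eqP; ring.
Qed.

Lemma lower_bound :
  ((lower_constant (L / alpha) #|` mesh0 D|)^-1%:E * approx_norm D s <= supmesh)%E.
Proof. by rewrite lee_pdivrMl ?lower_constant_gt0// approx_norm_le. Qed.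

Lemma mesh_le_cost p : indices r p ->
  ((#|` mesh r p.1|)%:R - (#|` mesh0 D|)%:R + 1) `^ s * quasi_error r p <=
  cumulative_cost r p `^ s * quasi_error r p.
Proof.
move=> ip; have rl : level_reached r p.1 by case: ip.
apply: ler_wpM2r; first exact: quasi_error_ge0.
have fin := indices_le_finite ip.
have n0 : 1 <= #|` mesh0 D|%:R :> R by rewrite ler1n cardfs_gt0 mesh0_neq0.
have cl : #|` mesh0 D|%:R <= #|` mesh r p.1|%:R :> R by rewrite ler_nat card_mesh0_le.
have cost : #|` mesh r p.1|%:R <= cumulative_cost r p.
  rewrite /cumulative_cost fsbig_finite//= (big_fsetD1 p)/=.
    by rewrite lerDl sumr_ge0.
  by rewrite in_fset_set// inE/=; split => //; rewrite index_leE leqnn eqxx orbT.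
apply: (ge0_ler_powR (ltW s0)); rewrite ?nnegrE; lra.
Qed.

End LowerBound.
Theorem theorem7 (R : realType) :
  exists (* L/alpha, Cson, Cstab, Crel, #T_0, s, exceptional level *)
         (c_opt : R -> R -> R -> R -> nat -> R -> option nat -> R)
         (* Cstab, qred, Crel, Cmesh, 1 - lambda/lambda_opt, Cmark, Crel',
            Clin, qlin, #T_0, s *)
         (C_opt : R -> R -> R -> R -> R -> R -> R -> R -> R -> nat -> R -> R),
  [/\ forall kappa Cson Cstab Crel n s e,
        0 < c_opt kappa Cson Cstab Crel n s e,
      forall Cstab qred Crel Cmesh delta Cmark Crel' Clin qlin n s,
        0 < C_opt Cstab qred Crel Cmesh delta Cmark Crel' Clin qlin n s &
  forall (k : scalars) (M : model R k) (D : discretization M)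
    (c : contraction_kind)
    (alpha L qctr Cson Cmesh Cstab qred Crel : R)
    (theta lambda Cmark s : R),
  0 < alpha <= L -> strongly_monotone M alpha -> lipschitz_operator M L ->
  0 < qctr < 1 -> contractive D c qctr ->
  2 <= Cson -> son_estimate D Cson ->
  overlay_estimate D ->
  0 < Cmesh -> closure_estimate D Cmesh ->
  0 < Cstab -> stability D Cstab ->
  0 < qred < 1 -> reduction D qred ->
  0 < Crel -> reliability D Crel -> discrete_reliability D Crel ->
  0 < theta <= 1 ->
  let lopt := lambda_opt c qctr Cstab alpha in
  0 < lambda < lopt * theta ->
  0 < (theta + lambda / lopt) / (1 - lambda / lopt)
    < (Num.sqrt (1 + Cstab ^+ 2 * Crel ^+ 2))^-1 ->
  1 <= Cmark -> 0 < s ->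
  forall r : run D, adaptive_run c theta lambda Cmark r ->
  forall Clin qlin Crel' : R,
  1 <= Clin -> 0 < qlin < 1 -> linear_convergence Clin qlin r ->
  0 < Crel' -> error_control c Crel' r ->
  let supmesh := ereal_sup
    [set (((#|` mesh r p.1|)%:R - (#|` mesh0 D|)%:R + 1) `^ s
          * quasi_error r p)%:E | p in indices r] in
  let supcost := ereal_sup
    [set (cumulative_cost r p `^ s * quasi_error r p)%:E | p in indices r] in
  [/\ forall e, exceptional_level r e ->
        ((c_opt (L / alpha) Cson Cstab Crel #|` mesh0 D| s e)^-1%:E
           * approx_norm D s <= supmesh)%E,
      (supmesh <= supcost)%E &
      (supcost <= (C_opt Cstab qred Crel Cmesh (1 - lambda / lopt) Cmark Crel'
                     Clin qlin #|` mesh0 D| s)%:E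
         * maxe (approx_norm D s) (quasi_error r (0%N, 0%N))%:E)%E]].
Proof.
exists (fun kappa Cson Cstab _ n s _ => lower_constant Cson Cstab s kappa n).
exists (fun Cstab _ Crel Cmesh delta Cmark Crel' Clin qlin n s =>
  upper_constant Cstab Crel Cmesh delta Cmark Crel' Clin qlin n s).
split; [by move=> *; exact: lower_constant_gt0|by move=> *; exact: upper_constant_gt0|].
move=> k M D c alpha L qctr Cson Cmesh Cstab qred Crel theta lambda Cmark s.
move=> alphaL mono lip qctr01 ctr Cson2 son ovl Cmesh0 clos Cstab0 stab qred01 red.
move=> Crel0 rel drel theta01 lopt lambda_theta theta_opt Cmark1 s0 r rP.
move=> Clin qlin Crel' Clin1 qlin01 lin Crel'0 control supmesh supcost.
have [alpha0 _] := andP alphaL; have [theta0 _] := andP theta01.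
have Cson1 : 1 <= Cson by apply: le_trans Cson2; rewrite ler1n.
split.
- by move=> e _; exact: (lower_bound alphaL mono lip Cson1 son Cstab0 stab s0 theta0 rP
    Clin1 qlin01 lin control).
- apply: ge_ereal_sup => _ [p ip <-].
  apply: (@le_trans _ _ (cumulative_cost r p `^ s * quasi_error r p)%:E).
    by rewrite lee_fin; exact: (mesh_le_cost son s0 rP).
  by apply: ereal_sup_ubound; exists p.
- set C := upper_constant _ _ _ _ _ _ _ _ _ _.
  have C0 : 0 < C by exact: upper_constant_gt0.
  set m := maxe _ _.
  have start_m : ((quasi_error r (0%N, 0%N))%:E <= m)%E by rewrite le_max lexx orbT.
  have approx_m : (approx_norm D s <= m)%E by rewrite le_max lexx.
  case: m start_m approx_m => [B| |] start_m approx_m.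
  + rewrite -EFinM; apply: ge_ereal_sup => _ [p ip <-]; rewrite lee_fin.
    exact: (cost_error_le alpha0 mono qctr01 ctr son ovl Cmesh0 clos Cstab0 stab qred01
      red Crel0 drel s0 Cmark1 rP lambda_theta theta01 theta_opt Clin1 qlin01 lin Crel'0
      control approx_m).
  + by rewrite gt0_muley ?lte_fin// leey.
  + by move: start_m; rewrite leeNy_eq.
Qed.
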